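(* Let $k\in\mathbb{N}_0$ and $r\in[0,\infty)$ be fixed and such that $\max\{k,r\}>0$. Then, as $n\to\infty$, $$\frac{\mathrm{Lah}(n,k)_r-(k+r)\log n}{\sqrt{(k+r)\log n}}\longrightarrow\mathcal{N}(0,1)\quad\text{in distribution},$$ where $\mathcal{N}(0,1)$ is the standard normal distribution.
   Context: $\mathbb{N}=\{1,2,\ldots\}$, $\mathbb{N}_0=\mathbb{N}\cup\{0\}$. Let $\genfrac{[}{]}{0pt}{}{n}{k}$ and $\genfrac{\{}{\}}{0pt}{}{n}{k}$ be the (unsigned) Stirling numbers of the first kind (number of permutations of $\{1,\dots,n\}$ with exactly $k$ cycles) and of the second kind (number of partitions of $\{1,\dots,n\}$ into $k$ non-empty subsets). For $n\in\mathbb{N}_0$, $k\in\{0,\ldots,n\}$ and $r\in\mathbb{R}$ the $r$-Stirling numbers are defined (with $0^0=1$) by $$\genfrac{[}{]}{0pt}{}{n}{k}_r=\sum_{j=k}^n\genfrac{[}{]}{0pt}{}{n}{j}\binom{j}{k}r^{j-k},\qquad \genfrac{\{}{\}}{0pt}{}{n}{k}_r=\sum_{j=k}^n\binom{n}{j}\genfrac{\{}{\}}{0pt}{}{j}{k}r^{n-j}.$$ The $r$-Lah number is $L(n,k)_r=\sum_{j=k}^n\genfrac{[}{]}{0pt}{}{n}{j}_r\genfrac{\{}{\}}{0pt}{}{j}{k}_r$. For $n\in\mathbb{N}$, $k\in\{0,\ldots,n\}$, $r\in[0,\infty)$ with $\max\{k,r\}>0$, $\mathrm{Lah}(n,k)_r$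 denotes a random variable with the $r$-Lah distribution $$\mathbb{P}[\mathrm{Lah}(n,k)_r=j]=\frac{1}{L(n,k)_r}\genfrac{[}{]}{0pt}{}{n}{j}_r\genfrac{\{}{\}}{0pt}{}{j}{k}_r,\qquad j\in\{k,k+1,\ldots,n\}.$$ *)

(* Defs.v *)
From HB Require Import structures.
From mathcomp Require Import all_boot all_order all_algebra.
From mathcomp Require Import fingroup perm.

Set Implicit Arguments.
Unset Strict Implicit.
Unset Printing Implicit Defensive.

Definition stirling1 (n k : nat) : nat :=
  #|[set s : 'S_n | #|porbits s| == k]|.

Definition stirling2 (n k : nat) : nat :=
  #|[set B : {set {set 'I_n}} | partition B [set: 'I_n] & #|B| == k]|.

(* Loaded only now: these libraries rebind [set _ | _] and partition to their
   classical_sets counterparts. *)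
From mathcomp Require Import all_classical all_reals all_analysis.
From mathcomp Require Import measurable_realfun.

Import Order.TTheory GRing.Theory Num.Theory.
Import numFieldNormedType.Exports.

Local Open Scope classical_set_scope.
Local Open Scope ring_scope.

Section rStirling.
Context {R : realType}.
Implicit Types (n k j : nat) (r : R).

Definition rstirling1 n k r : R :=
  \sum_(k <= j < n.+1) (stirling1 n j)%:R * 'C(j, k)%:R * r ^+ (j - k).

Definition rstirling2 n k r : R :=
  \sum_(k <= j < n.+1) 'C(n, j)%:R * (stirling2 j k)%:R * r ^+ (n - j).

Definition rlah n k r : R :=
  \sum_(k <= j < n.+1) rstirling1 n j r * rstirling2 j k r.

Definition lah_pmf n k r j : R :=
  (rlah n k r)^-1 * (rstirling1 n j r * rstirling2 j k r).

End rStirling.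

(* These values sum to 1 over k <= j <= n, so they determine the law of X. *)
Definition lah_distributed (d : measure_display) (T : measurableType d)
    (R : realType) (P : probability T R) (n k : nat) (r : R)
    (X : {RV P >-> R}) : Prop :=
  forall j : nat, (k <= j <= n)%N ->
    P (X @^-1` [set j%:R]) = (lah_pmf n k r j)%:E.

(* (X - m) / s *)
Definition standardize (d : measure_display) (T : measurableType d)
    (R : realType) (P : probability T R) (X : {RV P >-> R}) (m s : R) :
    {RV P >-> R} :=
  s^-1 \o* (X \- cst m).

(* The X n may live on different probability spaces; the limit is given by its
   law mu only. *)
Definition cvg_in_distribution (R : realType) (d : nat -> measure_display)
    (T : forall n : nat, measurableType (d n))
    (P : forall n : nat, probability (T n) R)
    (X : forall n : nat, {RV (P n) >-> R})
    (mu : probability (measurableTypeR R) R) : Prop :=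
  forall x : R, {for x, continuous (fun y : R => mu `]-oo, y]%classic)} ->
    cdf (X n) x @[n --> \oo] --> mu `]-oo, x]%classic.

(* Main.v *)
Require Import Defs.
From mathcomp Require Import all_boot all_order all_algebra.
From mathcomp Require Import fingroup perm.

(** Put theta = k + r. From (k + r)^j = sum_(i <= k) k^_i {j, i}_r one gets
    0 <= (k + r)^j - k! {j, k}_r <= sum_(i < k) C(k, i) (i + r)^j; weighting by
    [n, j]_r and summing over j, the right-hand side is negligible against
    prod_(m < n) (theta + r + m). Hence the r-Lah law is asymptotically, in
    total variation, the law with weights [n, j]_r theta^j, whose generating
    function factors: it is the law of a sum of independent Bernoulli variables
    with parameters theta / (theta + r + m), m < n. Mean and variance of that
    sum are theta log n + O(1), and the central limit theorem for it follows
    from Stein's method: for g Lipschitz with compact support and Gaussian mean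
    0, the equation F' - x F = g has a solution with F' bounded and Lipschitz,
    and E[F'(W) - W F(W)] tends to 0. Tightness extends this to the ramp
    functions which bracket the indicator of a half-line. *)

Set Implicit Arguments.
Unset Strict Implicit.
Unset Printing Implicit Defensive.

Import GRing.Theory.

Local Open Scope ring_scope.

(** * Stirling numbers *)

Lemma lift_permX n (s : 'S_n) i :
  (lift_perm ord0 ord0 s ^+ i)%g = lift_perm ord0 ord0 (s ^+ i)%g.
Proof.
elim: i => [|i IHi]; first by rewrite !expg0 lift_perm1.
by rewrite !expgS IHi lift_permM.
Qed.

(** The lifted permutation fixes [ord0] and acts as [s] on the other points, so its orbits are the
    singleton of [ord0] and the lifted orbits of [s]. *)
Lemma card_porbits_lift_perm n (s : 'S_n) :
  #|porbits (lift_perm ord0 ord0 s)| = #|porbits s|.+1.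
Proof.
set l := lift_perm ord0 ord0 s.
have l0 : porbit l ord0 = [set ord0].
  apply/setP => y; rewrite !inE; apply/porbitP/eqP => [[i ->]|->].
    by rewrite lift_permX lift_perm_id.
  by exists 0; rewrite expg0 perm1.
have lS i : porbit l (lift ord0 i) = lift ord0 @: porbit s i.
  apply/setP => y; apply/porbitP/imsetP => [[k ->]|[j /porbitP[k ->] ->]].
    by exists ((s ^+ k)%g i); rewrite ?mem_porbit// lift_permX lift_perm_lift.
  by exists k; rewrite lift_permX lift_perm_lift.
have -> : porbits l =
    [set ord0] |: [set lift ord0 @: (B : {set _}) | B in porbits s].
  apply/setP => B; rewrite !inE; apply/imsetP/orP => [[i _ ->]|[/eqP->|]].
  - case: (unliftP ord0 i) => [j|] ->; last by left; rewrite l0.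
    by right; rewrite lS imset_f// imset_f.
  - by exists ord0.
  - by case/imsetP => _ /imsetP[j _ ->] ->; exists (lift ord0 j).
rewrite cardsU1 card_imset; last exact/imset_inj/lift_inj.
case: imsetP => // -[B _ /setP/(_ ord0)]; rewrite !inE eqxx.
by move=> /esym/imsetP[j _ /eqP]; rewrite (negbTE (neq_lift _ _)).
Qed.

(** For [i] other than [ord0] the transposition merges the fixed point [ord0] into the cycle of [i],
    which cancels the extra cycle; for [i = ord0] it is the identity. *)
Lemma card_porbits_tperm_lift n (i : 'I_n.+1) (s : 'S_n) :
  #|porbits (tperm ord0 i * lift_perm ord0 ord0 s)%g|
    = ((i == ord0) + #|porbits s|)%N.
Proof.
have := porbits_mul_tperm (lift_perm ord0 ord0 s) ord0 i => /=.
rewrite card_porbits_lift_perm.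
case: (unliftP ord0 i) => [j|] ->; last by rewrite porbit_id eqxx !addn0.
have -> : ord0 \notin porbit (lift_perm ord0 ord0 s) (lift ord0 j).
  apply/porbitP => -[k /eqP].
  by rewrite lift_permX lift_perm_lift (negbTE (neq_lift _ _)).
by rewrite neq_lift eq_sym (negbTE (neq_lift _ _)) addn1 addn2 => -[->].
Qed.

(** Every permutation of [n + 1] points is uniquely a transposition of [ord0] and some [i] times a
    lifted permutation. Summing over [i] yields the new factor: [x] for [i = ord0], and 1 for each
    of the [n] other choices. *)
Lemma sum_expr_porbits (R : comNzRingType) n (x : R) :
  \sum_(s : 'S_n) x ^+ #|porbits s| = \prod_(i < n) (x + i%:R).
Proof.
elim: n => [|n IHn].
  rewrite big_ord0 (eq_bigr (fun=> 1)); last first.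
    move=> s _; rewrite (_ : porbits s = set0) ?cards0//.
    by apply/setP => B; rewrite inE; apply/imsetP => -[[]].
  by rewrite big_const card_Sn /= addr0.
pose h (z : 'I_n.+1 * 'S_n) := (tperm ord0 z.1 * lift_perm ord0 ord0 z.2)%g.
have hinj : injective h.
  move=> [i s] [j t]; rewrite /h /= => eqh.
  (* [i] is recovered from the product as the point sent to [ord0]. *)
  have ij : i = j.
    apply: (@perm_inj _ (tperm ord0 i * lift_perm ord0 ord0 s)%g).
    by rewrite {2}eqh !permM !tpermR !lift_perm_id.
  move: eqh; rewrite ij => /mulgI eqh; congr pair; apply/permP => k.
  by apply: (@lift_inj _ ord0); rewrite -!(lift_perm_lift ord0) eqh.
have hbij : bijective h.
  apply: inj_card_bij => //.
  by rewrite card_prod !card_Sn card_ord factS.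
rewrite (reindex h) /=; last exact: onW_bij.
rewrite -(pair_bigA _ (fun i s => x ^+ #|porbits (h (i, s))|)) /=.
under eq_bigr do under eq_bigr do rewrite card_porbits_tperm_lift exprD.
under eq_bigr do rewrite -mulr_sumr IHn.
rewrite -mulr_suml [RHS]big_ord_recr /= mulrC; congr (_ * _).
rewrite big_ord_recl; congr (_ + _).
by rewrite (eq_bigr (fun=> 1))// sumr_const card_ord.
Qed.

Lemma sum_stirling1_expr (R : comNzRingType) n (x : R) :
  \sum_(j < n.+1) (stirling1 n j)%:R * x ^+ j = \prod_(i < n) (x + i%:R).
Proof.
rewrite -sum_expr_porbits.
have porbits_le (s : 'S_n) : (#|porbits s| < n.+1)%N.
  by rewrite ltnS -[leqRHS]card_ord leq_imset_card.
rewrite (partition_big (fun s : 'S_n => Ordinal (porbits_le s)) xpredT) //=.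
apply: eq_bigr => j _; rewrite /stirling1 -sum1dep_card natr_sum mulr_suml.
by apply: eq_big => [s|s /eqP <-]; rewrite ?mul1r.
Qed.

Lemma preim_partition_eqP (n i : nat) (B : {set {set 'I_n}})
    (f : {ffun 'I_n -> 'I_i}) : partition B [set: 'I_n] ->
  (preim_partition f [set: 'I_n] == B) =
  [forall x, forall y, (f x == f y) == (pblock B x == pblock B y)].
Proof.
move=> pB; have /and3P[/eqP covB tB _] := pB.
have covx x : x \in cover B by rewrite covB inE.
apply/eqP/forallP => [Bf x|Bf].
  apply/forallP => y; apply/eqP.
  rewrite eq_pblock// -Bf /preim_partition pblock_equivalence_partition ?inE//.
  by split=> // /eqP ->.
rewrite -(equivalence_partition_pblock pB).
apply: eq_imset => x; apply/setP => y; rewrite !inE /=.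
by have /forallP/(_ y)/eqP -> := Bf x; rewrite eq_pblock.
Qed.

(** A function whose fibres are the blocks of [B] is the block map followed by an injection of the
    set [D] of blocks into ['I_i]; [Psi] is this composition. *)
Lemma card_preim_partition (n i : nat) (B : {set {set 'I_n}}) :
  partition B [set: 'I_n] ->
  #|[set f : {ffun 'I_n -> 'I_i} | preim_partition f [set: 'I_n] == B]|
    = i ^_ #|B|.
Proof.
move=> pB; have /and3P[/eqP covB tB nB] := pB.
have memB x : pblock B x \in B by rewrite pblock_mem// covB inE.
pose D : finType := {b | b \in B}.
pose blk x : D := exist _ (pblock B x) (memB x).
have blk_surj (b : D) : exists x, blk x = b.
  case: b => b bB; have /set0Pn[x xb] : b != set0 by apply: contraNneq nB => <-.
  by exists x; apply: val_inj; rewrite /= (def_pblock tB bB xb).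
pose Psi (g : {ffun D -> 'I_i}) : {ffun 'I_n -> 'I_i} := [ffun x => g (blk x)].
have Psi_inj : injective Psi.
  move=> g h /ffunP gh; apply/ffunP => b; have [x <-] := blk_surj b.
  by have := gh x; rewrite !ffunE.
have <- : #|D| = #|B| by rewrite card_sig.
transitivity #|[set g : {ffun D -> 'I_i} | injectiveb g]|; last first.
  by rewrite card_inj_ffuns card_ord.
rewrite -(card_imset _ Psi_inj).
congr #|pred_of_set _|; apply/setP => f; rewrite inE (preim_partition_eqP _ pB).
apply/forallP/imsetP => [fB|[g]].
  (* [e] picks a representative in every block. *)
  have [e eK] := fin_all_exists blk_surj.
  have fe x : f (e (blk x)) = f x.
    apply/eqP; have /forallP/(_ x)/eqP -> := fB (e (blk x)).
    by apply/eqP; have := congr1 val (eK (blk x)).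
  exists [ffun b => f (e b)]; last by apply/ffunP => x; rewrite !ffunE fe.
  rewrite inE; apply/injectiveP => a b; rewrite !ffunE => /eqP.
  have /forallP/(_ (e b))/eqP -> := fB (e a); move/eqP => eab.
  by rewrite -(eK a) -(eK b); apply: val_inj.
rewrite inE => /injectiveP ginj -> x; apply/forallP => y.
by rewrite !ffunE (inj_eq ginj) -val_eqE.
Qed.

Lemma stirling2_small n k : (n < k)%N -> stirling2 n k = 0%N.
Proof.
move=> nk; apply/eqP; rewrite cards_eq0; apply/eqP/setP => B.
rewrite !inE; apply/negbTE/andP => -[pB /eqP Bk].
have := card_partition pB; rewrite cardsT card_ord => n_sum.
have : (#|B| <= \sum_(A in B) #|A|)%N.
  rewrite -sum1_card leq_sum// => A AB; rewrite lt0n cards_eq0.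
  by apply: contraTneq AB => ->; case/and3P: pB.
by rewrite -n_sum Bk leqNgt nk.
Qed.

(** All functions from ['I_n] to ['I_i] are counted by their partition into fibres, and the
    partitions then by their number of blocks. *)
Lemma expn_sum_stirling2 i n :
  (i ^ n = \sum_(k < i.+1) stirling2 n k * i ^_ k)%N.
Proof.
rewrite -{1}(card_ord i) -{1}(card_ord n) -card_ffun -sum1_card.
pose PT := [set B : {set {set 'I_n}} | partition B [set: 'I_n]].
have pp (f : {ffun 'I_n -> 'I_i}) : preim_partition f [set: 'I_n] \in PT.
  by rewrite inE preim_partitionP.
rewrite (partition_big
  (fun f : {ffun 'I_n -> 'I_i} => preim_partition f [set: 'I_n]) (mem PT)) //=.
under eq_bigr => B; first rewrite inE => pB.
  rewrite sum1dep_card card_preim_partition//; over.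
(* Partitions with more than [i] blocks contribute a zero falling factorial; discarding them first
   makes [inord #|B|] below the true number of blocks. *)
rewrite (bigID (fun B : {set {set 'I_n}} => (#|B| < i.+1)%N)) /=.
rewrite [X in (_ + X)%N]big1 ?addn0; last first.
  by move=> B /andP[_]; rewrite -leqNgt => iB; rewrite ffact_small.
rewrite (partition_big
  (fun B : {set {set 'I_n}} => inord #|B| : 'I_i.+1) xpredT) //=.
apply: eq_bigr => k _; rewrite /stirling2 -sum1dep_card big_distrl /=.
apply: eq_big => [B|B /andP[/andP[_ Bi] /eqP<-]]; last by rewrite inordK ?mul1n.
rewrite inE -andbA; congr andb; apply/andP/eqP => [[Bi /eqP <-]|->].
  by rewrite inordK.
by rewrite ltn_ord; split=> //; rewrite inord_val.
Qed.

From mathcomp Require Import all_classical all_reals all_analysis.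
From mathcomp Require Import measurable_realfun ring lra.

Import Order.TTheory GRing.Theory Num.Theory.
Import numFieldNormedType.Exports.

Local Open Scope classical_set_scope.
Local Open Scope ring_scope.

(** * r-Stirling numbers and the r-Lah law *)

Lemma rstirling1_ge0 (R : realType) n k (r : R) :
  0 <= r -> 0 <= rstirling1 n k r.
Proof. by move=> r0; apply: sumr_ge0 => j _; rewrite !mulr_ge0 ?exprn_ge0. Qed.

Lemma rstirling2_ge0 (R : realType) n k (r : R) :
  0 <= r -> 0 <= rstirling2 n k r.
Proof. by move=> r0; apply: sumr_ge0 => j _; rewrite !mulr_ge0 ?exprn_ge0. Qed.

Lemma rstirling2_small (R : realType) n k (r : R) :
  (n < k)%N -> rstirling2 n k r = 0.
Proof. by move=> nk; rewrite /rstirling2 big_geq. Qed.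

Lemma rstirling2E (R : realType) n k (r : R) :
  rstirling2 n k r =
  \sum_(j < n.+1) 'C(n, j)%:R * (stirling2 j k)%:R * r ^+ (n - j).
Proof.
have [nk|kn] := ltnP n k.
  rewrite rstirling2_small// big1// => j _.
  by rewrite stirling2_small ?mulr0 ?mul0r// (leq_ltn_trans _ nk)// -ltnS.
rewrite -(big_mkord xpredT
  (fun j => 'C(n, j)%:R * (stirling2 j k)%:R * r ^+ (n - j))).
rewrite (@big_cat_nat _ _ _ k)//=; last exact: leqW.
rewrite big_nat big1 ?add0r// => j /andP[_ jk].
by rewrite stirling2_small ?mulr0 ?mul0r.
Qed.

(** Expand by the binomial theorem and apply [expn_sum_stirling2] to each power of [k]. *)
Lemma expr_sum_rstirling2 (R : realType) n k (r : R) :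
  (k%:R + r) ^+ n = \sum_(i < k.+1) (k ^_ i)%:R * rstirling2 n i r.
Proof.
rewrite addrC exprDn.
under [RHS]eq_bigr do rewrite rstirling2E mulr_sumr.
rewrite exchange_big /=; apply: eq_bigr => j _.
rewrite -natrX expn_sum_stirling2 natr_sum mulr_sumr -sumrMnl.
by apply: eq_bigr => i _; rewrite natrM -mulr_natl; ring.
Qed.

Lemma fact_rstirling2_le (R : realType) n k (r : R) : 0 <= r ->
  k`!%:R * rstirling2 n k r <= (k%:R + r) ^+ n.
Proof.
move=> r0; rewrite expr_sum_rstirling2 big_ord_recr /= ffactnn lerDr.
by apply: sumr_ge0 => i _; rewrite mulr_ge0// rstirling2_ge0.
Qed.

(** The gap consists of the terms [i < k] of [expr_sum_rstirling2]. The falling factorial there is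
    ['C(k, i) * i!], and [fact_rstirling2_le] bounds [i!] times the r-Stirling number. *)
Lemma rstirling2_gap (R : realType) n k (r : R) : 0 <= r ->
  (k%:R + r) ^+ n - k`!%:R * rstirling2 n k r
    <= \sum_(i < k) 'C(k, i)%:R * (i%:R + r) ^+ n.
Proof.
move=> r0; rewrite expr_sum_rstirling2 big_ord_recr /= ffactnn addrK.
apply: ler_sum => i _; rewrite -bin_ffact natrM -mulrA ler_wpM2l//.
exact: fact_rstirling2_le.
Qed.

(** Substitute ['X + r] into [sum_stirling1_expr] and expand each power by the binomial theorem. The
    factored generating function is what produces independent summands later. *)
Lemma coef_rstirling1 (R : realType) n k (r : R) :
  rstirling1 n k r = (\prod_(i < n) ('X + (r + i%:R)%:P))`_k.
Proof.
under eq_bigr do rewrite polyCD addrA polyC_natr.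
rewrite -sum_stirling1_expr coef_sum.
have coefj (j : nat) :
    ((stirling1 n j)%:R * ('X + r%:P) ^+ j)`_k =
    if (k <= j)%N then (stirling1 n j)%:R * 'C(j, k)%:R * r ^+ (j - k) else 0.
  rewrite mulr_natl coefMn addrC exprDn coef_sum.
  under eq_bigr do rewrite coefMn -polyC_exp coefCM coefXn.
  case: ifPn => [kj|]; last first.
    rewrite -ltnNge => jk; rewrite big1 ?mul0rn// => i _.
    by rewrite gtn_eqF ?mulr0 ?mul0rn// (leq_ltn_trans _ jk)// -ltnS.
  have kj' : (k < j.+1)%N by [].
  rewrite (bigD1 (Ordinal kj')) //= eqxx big1 ?addr0 ?mulr1.
    by rewrite -mulrnA -[in RHS]natrM mulr_natl mulnC.
  move=> i /eqP ik; rewrite (_ : (k == i) = false) ?mulr0 ?mul0rn//.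
  by apply/eqP => ki; apply: ik; apply: val_inj.
under eq_bigr do rewrite coefj.
rewrite -big_mkcond /rstirling1 /=.
rewrite -(big_mkord (fun i => (k <= i)%N)
  (fun j => (stirling1 n j)%:R * 'C(j, k)%:R * r ^+ (j - k))).
have [kn|nk] := leqP k n.+1.
  rewrite (@big_cat_nat _ _ _ k _ _ (fun i => (k <= i)%N))//=.
  rewrite [X in _ = X + _]big1_seq ?add0r.
    rewrite big_nat_cond [RHS]big_nat_cond; apply: eq_bigl => i.
    by case: (k <= i)%N; rewrite ?andbF.
  by move=> i /andP[ki]; rewrite mem_index_iota ltnNge ki andbF.
(* Here [k > n + 1]: the defining sum is empty and no index of the other sum reaches [k]. *)
rewrite big_geq ?(ltnW nk)// big1_seq// => i /andP[ki].
rewrite mem_index_iota => /andP[_ iN].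
by have := leq_trans (leq_trans iN (ltnW nk)) ki; rewrite ltnn.
Qed.

(* The expectation of f(B_1 + ... + B_m) for independent Bernoulli variables
   whose success probabilities are the entries of the list. *)
Fixpoint bernE (R : realType) (ps : seq R) (f : nat -> R) : R :=
  if ps is p :: ps' then
    (1 - p) * bernE ps' f + p * bernE ps' (fun j => f j.+1)
  else f 0%N.

(** At [X = x z] the factor [X + a] is [x + a] times the generating function in [z] of a Bernoulli
    variable with parameter [x / (x + a)], so each factor adds one independent summand. The bound
    [N] is left free because the shifted half of the recursion loses one index. *)
Lemma sum_coef_prodXDC (R : realType) (x : R) (s : seq R) N (f : nat -> R) :
  all (fun a => x + a != 0) s -> (size s < N)%N ->
  \sum_(j < N) (\prod_(a <- s) ('X + a%:P))`_j * x ^+ j * f j =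
  (\prod_(a <- s) (x + a)) * bernE [seq x / (x + a) | a <- s] f.
Proof.
elim: s N f => [|a s IHs] N f /=.
  case: N => // N _ _; rewrite !big_nil mul1r big_ord_recl big1 ?addr0.
    by rewrite coef1 !mul1r.
  by move=> i _; rewrite coef1 !mul0r.
move=> /andP[xa0 s0]; case: N => // N; rewrite ltnS => sN.
rewrite !big_cons; set Q := \prod_(_ <- s) _.
have -> : \sum_(j < N.+1) (('X + a%:P) * Q)`_j * x ^+ j * f j =
    x * (\sum_(j < N) Q`_j * x ^+ j * f j.+1) +
    a * (\sum_(j < N.+1) Q`_j * x ^+ j * f j).
  under eq_bigr do rewrite mulrDl coefD coefXM coefCM !mulrDl.
  rewrite big_split /=; congr (_ + _).
    rewrite big_ord_recl /= !mul0r add0r mulr_sumr.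
    by apply: eq_bigr => i _; rewrite /bump /= add1n exprS; ring.
  by rewrite mulr_sumr; apply: eq_bigr => i _; ring.
rewrite (IHs _ (fun j => f j.+1))// IHs//; last exact: ltnW.
by field.
Qed.

Definition rlah_ps (R : realType) k (r : R) n : seq R :=
  [seq (k%:R + r) / (k%:R + r + (r + i%:R)) | i <- index_iota 0 n].

Lemma sum_rstirling1_bernE (R : realType) n k (r : R) (f : nat -> R) :
  0 <= r -> 0 < k%:R + r ->
  \sum_(j < n.+1) rstirling1 n j r * (k%:R + r) ^+ j * f j =
  (\prod_(i < n) (k%:R + r + (r + i%:R))) * bernE (rlah_ps k r n) f.
Proof.
move=> r0 kr0.
have := @sum_coef_prodXDC R (k%:R + r) [seq r + i%:R | i <- index_iota 0 n] n.+1 f.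
rewrite size_map size_iota subn0 ltnS leqnn -map_comp !big_map !big_mkord.
move=> /(_ _ isT) <-; last first.
  apply/allP => _ /mapP[i _ ->]; rewrite gt_eqF// ltr_wpDr// addr_ge0//.
by apply: eq_bigr => j _; rewrite coef_rstirling1.
Qed.

Lemma bernE_cst (R : realType) (ps : seq R) (c : R) : bernE ps (fun=> c) = c.
Proof. by elim: ps => //= p ps ->; ring. Qed.

Lemma sum_rstirling1 (R : realType) n (r x : R) :
  \sum_(j < n.+1) rstirling1 n j r * x ^+ j = \prod_(i < n) (x + (r + i%:R)).
Proof.
under eq_bigr do rewrite coef_rstirling1.
rewrite -horner_coef_wide; last first.
  under eq_bigr do rewrite -[(_ + _)%:P]opprK -polyCN.
  by rewrite size_prod_XsubC /index_enum -enumT size_enum_ord.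
rewrite horner_prod; apply: eq_bigr => i _; by rewrite !hornerE.
Qed.

(** * Comparison of the r-Lah law with a Bernoulli sum in total variation *)

Section total_variation.
Context {R : realType} (k : nat) (r : R).
Hypotheses (r0 : 0 <= r) (kr0 : 0 < k%:R + r).

(** The bound of [rstirling2_gap], weighted by the r-Stirling numbers of the first kind, summed, and
    divided by the total mass [A n] of the Bernoulli weights. *)
Definition lah_gap n : R := \sum_(i < k) 'C(k, i)%:R *
  \prod_(m < n) ((i%:R + r + (r + m%:R)) / (k%:R + r + (r + m%:R))).

(** Unnormalised weights: [a] belongs to the Bernoulli sum and has total mass [A]; [b] belongs to
    the r-Lah law, scaled by [k!] so that it lies below [a] pointwise. *)
Let A n : R := \prod_(m < n) (k%:R + r + (r + m%:R)).
Let a n j : R := rstirling1 n j r * (k%:R + r) ^+ j.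
Let b n j : R := rstirling1 n j r * (k`!%:R * rstirling2 j k r).

Let A_gt0 n : 0 < A n.
Proof. by apply: prodr_gt0 => i _; rewrite ltr_wpDr// addr_ge0. Qed.

Let b_ge0 n j : 0 <= b n j.
Proof. by rewrite !mulr_ge0 ?rstirling1_ge0 ?rstirling2_ge0. Qed.

Let b_le_a n j : b n j <= a n j.
Proof. by rewrite ler_wpM2l ?rstirling1_ge0 ?fact_rstirling2_le. Qed.

Let sum_a n : \sum_(j < n.+1) a n j = A n.
Proof. exact: sum_rstirling1. Qed.

Let sum_ab n : \sum_(j < n.+1) (a n j - b n j) <= lah_gap n * A n.
Proof.
have -> : lah_gap n * A n = \sum_(i < k) 'C(k, i)%:R *
    \sum_(j < n.+1) rstirling1 n j r * (i%:R + r) ^+ j.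
  rewrite mulr_suml; apply: eq_bigr => i _; rewrite sum_rstirling1.
  rewrite -mulrA; congr (_ * _); rewrite big_split /= prodfV mulfVK//.
  by rewrite gt_eqF// A_gt0.
under [leRHS]eq_bigr do rewrite mulr_sumr.
rewrite exchange_big /=; apply: ler_sum => j _; rewrite -mulrBr.
under eq_bigr do rewrite mulrCA; rewrite -mulr_sumr.
by rewrite ler_wpM2l ?rstirling1_ge0// rstirling2_gap.
Qed.

Let sum_lah n (f : nat -> R) : (k <= n)%N ->
  \sum_(k <= j < n.+1) rstirling1 n j r * rstirling2 j k r * f j =
  k`!%:R^-1 * \sum_(j < n.+1) b n j * f j.
Proof.
move=> kn; rewrite -(big_mkord xpredT (fun j => b n j * f j)).
rewrite (@big_cat_nat _ _ _ k 0)//=; last exact: leqW.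
rewrite [X in _ * (X + _)]big_nat [X in _ * (X + _)]big1 ?add0r.
  rewrite mulr_sumr; apply: eq_bigr => j _; rewrite /b.
  by field; rewrite pnatr_eq0 -lt0n fact_gt0.
by move=> j /andP[_ jk]; rewrite /b rstirling2_small// !mulr0 mul0r.
Qed.

Let rlahE n : (k <= n)%N -> rlah n k r = k`!%:R^-1 * \sum_(j < n.+1) b n j.
Proof.
move=> kn; have := sum_lah (fun=> 1) kn.
under eq_bigr do rewrite mulr1.
by under [in X in _ = X -> _]eq_bigr do rewrite mulr1.
Qed.

Let sum_b_gt0 n : lah_gap n < 1 -> 0 < \sum_(j < n.+1) b n j.
Proof.
move=> g1; have := sum_ab n; rewrite sumrB sum_a => h.
have : lah_gap n * A n < A n by rewrite gtr_pMl.
lra.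
Qed.

Let sum_pmf n (f : nat -> R) : (k <= n)%N ->
  \sum_(k <= j < n.+1) lah_pmf n k r j * f j =
  (\sum_(j < n.+1) b n j * f j) / (\sum_(j < n.+1) b n j).
Proof.
move=> kn; rewrite /lah_pmf; under eq_bigr do rewrite -mulrA.
by rewrite -mulr_sumr sum_lah// rlahE// invfM invrK mulrACA divff ?mul1r 1?mulrC.
Qed.

Lemma lah_pmf_ge0 n j : 0 <= lah_pmf n k r j.
Proof.
rewrite /lah_pmf mulr_ge0 ?invr_ge0// ?mulr_ge0 ?rstirling1_ge0 ?rstirling2_ge0//.
by apply: sumr_ge0 => i _; rewrite mulr_ge0 ?rstirling1_ge0 ?rstirling2_ge0.
Qed.

Lemma sum_lah_pmf n : (k <= n)%N -> lah_gap n < 1 ->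
  \sum_(k <= j < n.+1) lah_pmf n k r j = 1.
Proof.
move=> kn g1; have := sum_pmf (fun=> 1) kn.
under eq_bigr do rewrite mulr1.
under [in X in _ = X -> _]eq_bigr do rewrite mulr1.
by move=> ->; rewrite divff// gt_eqF// sum_b_gt0.
Qed.

(** Since [b <= a], normalising the two weights changes expectations of functions with values in
    [0, 1] by at most the relative missing mass, which [sum_ab] bounds by [lah_gap n]. *)
Lemma lah_pmf_bernE n (f : nat -> R) : (k <= n)%N -> lah_gap n < 1 ->
  (forall j, 0 <= f j <= 1) ->
  `|\sum_(k <= j < n.+1) lah_pmf n k r j * f j - bernE (rlah_ps k r n) f|
    <= lah_gap n.
Proof.
move=> kn g1 f01; rewrite sum_pmf//.
have -> : bernE (rlah_ps k r n) f = (\sum_(j < n.+1) a n j * f j) / A n.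
  by rewrite sum_rstirling1_bernE// mulrAC divff ?mul1r// gt_eqF// A_gt0.
have := sum_ab n; rewrite sumrB sum_a.
have := sum_b_gt0 g1; have := A_gt0 n.
have : 0 <= \sum_(j < n.+1) b n j * f j <= \sum_(j < n.+1) b n j.
  rewrite sumr_ge0/= => [|j _]; last by rewrite mulr_ge0//; case/andP: (f01 j).
  by apply: ler_sum => j _; rewrite ler_piMr//; case/andP: (f01 j).
have : 0 <= \sum_(j < n.+1) a n j * f j - \sum_(j < n.+1) b n j * f j
     <= A n - \sum_(j < n.+1) b n j.
  rewrite -sum_a -!sumrB sumr_ge0/= => [|j _]; last first.
    by rewrite -mulrBl mulr_ge0 ?subr_ge0//; case/andP: (f01 j).
  apply: ler_sum => j _; rewrite -mulrBl ler_piMr ?subr_ge0//.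
  by case/andP: (f01 j).
move: (\sum_(j < _) a n j * f j) (\sum_(j < _) b n j * f j).
move: (A n) (\sum_(j < _) b n j).
move=> a' b' af bf /andP[h1 h2] /andP[h3 h4] a'0 b'0 h5.
(* Both products in the numerator lie between 0 and [b' * (a' - b')], hence so does the absolute
   value of their difference. *)
have -> : bf / b' - af / a' = (bf * (a' - b') - (af - bf) * b') / (b' * a').
  by field; rewrite !gt_eqF.
rewrite normrM [X in _ * X]gtr0_norm ?invr_gt0 ?mulr_gt0//.
rewrite ler_pdivrMr ?mulr_gt0//.
have -> : lah_gap n * (b' * a') = b' * (lah_gap n * a') by ring.
apply: le_trans (_ : b' * (a' - b') <= _); last by rewrite ler_wpM2l// ltW.
have h6 : bf * (a' - b') <= b' * (a' - b') by rewrite ler_wpM2r//; lra.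
have h7 : 0 <= bf * (a' - b') by rewrite mulr_ge0//; lra.
have h8 : (af - bf) * b' <= b' * (a' - b') by rewrite mulrC ler_wpM2l// ltW.
have h9 : 0 <= (af - bf) * b' by rewrite mulr_ge0// ltW.
by rewrite ler_norml; apply/andP; split; lra.
Qed.

End total_variation.

(** * Sums of independent Bernoulli variables *)

Section bernE_theory.
Context {R : realType}.
Implicit Types (ps : seq R) (f g u : nat -> R).

Definition prob_seq ps := all (fun p => 0 <= p <= 1) ps.

Lemma eq_bernE ps f g : f =1 g -> bernE ps f = bernE ps g.
Proof. by move=> /funext ->. Qed.

Lemma bernED ps f g : bernE ps (fun j => f j + g j) = bernE ps f + bernE ps g.
Proof. by elim: ps f g => //= p ps IHps f g; rewrite !IHps; ring. Qed.

Lemma bernEZ ps (c : R) f : bernE ps (fun j => c * f j) = c * bernE ps f.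
Proof. by elim: ps f => //= p ps IHps f; rewrite !IHps; ring. Qed.

Lemma bernEB ps f g : bernE ps (fun j => f j - g j) = bernE ps f - bernE ps g.
Proof. by elim: ps f g => //= p ps IHps f g; rewrite !IHps; ring. Qed.

Lemma le_bernE ps f g : prob_seq ps -> (forall j, f j <= g j) ->
  bernE ps f <= bernE ps g.
Proof.
elim: ps f g => //= p ps IHps f g /andP[/andP[p0 p1] hps] fg.
by rewrite lerD// ler_wpM2l ?subr_ge0// IHps.
Qed.

Lemma bernE_norm_le ps f (M : R) : prob_seq ps -> (forall j, `|f j| <= M) ->
  `|bernE ps f| <= M.
Proof.
move=> hps fM; rewrite ler_norml -[M](bernE_cst ps) -[X in X <= _ <= _]mulN1r -bernEZ.
by rewrite !le_bernE// => j; have := fM j; rewrite ?mulN1r ler_norml => /andP[].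
Qed.

Definition bern_mean ps : R := \sum_(p <- ps) p.
Definition bern_var ps : R := \sum_(p <- ps) p * (1 - p).

(* Adding one Bernoulli(p) variable B to S contributes
   p (1 - p) E[f(S + 1) - f(S)] to E[(S - E S) f(S)], and this increment
   is compared with p (1 - p) E[u(S + B)]. *)
Lemma bernE_covariance ps f u (e : R) : prob_seq ps ->
  (forall j, `|f j.+1 - f j - u j| <= e) ->
  (forall j, `|f j.+1 - f j - u j.+1| <= e) ->
  `|bernE ps (fun j => (j%:R - bern_mean ps) * f j) - bern_var ps * bernE ps u|
    <= bern_var ps * e.
Proof.
elim: ps f u => [|p ps IHps] f u /=.
  by rewrite /bern_mean /bern_var !big_nil subrr !mul0r subr0 normr0.
move=> /andP[/andP[p0 p1] hps] fu fuS.
have q0 : 0 <= 1 - p by rewrite subr_ge0.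
have := IHps f u hps fu fuS.
have := IHps (fun j => f j.+1) (fun j => u j.+1) hps
  (fun j => fu j.+1) (fun j => fuS j.+1).
have := @bernE_norm_le ps
  (fun j => f j.+1 - f j - ((1 - p) * u j + p * u j.+1)) e hps.
rewrite /bern_mean /bern_var !big_cons -/(bern_mean ps) -/(bern_var ps).
rewrite bernEB bernEB bernED !bernEZ.
set m := bern_mean ps; set v := bern_var ps.
have -> : bernE ps (fun j => (j%:R - (p + m)) * f j) =
    bernE ps (fun j => (j%:R - m) * f j) - p * bernE ps f.
  by rewrite -bernEZ -bernEB; apply: eq_bernE => j; ring.
have -> : bernE ps (fun j => (j.+1%:R - (p + m)) * f j.+1) =
    bernE ps (fun j => (j%:R - m) * f j.+1) + (1 - p) * bernE ps (fun j => f j.+1).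
  by rewrite -bernEZ -bernED; apply: eq_bernE => j; rewrite -natr1; ring.
(* The two hypotheses on [u] are averaged over the value of the new Bernoulli variable. *)
have : forall j, `|f j.+1 - f j - ((1 - p) * u j + p * u j.+1)| <= e.
  move=> j; have -> : f j.+1 - f j - ((1 - p) * u j + p * u j.+1) =
     (1 - p) * (f j.+1 - f j - u j) + p * (f j.+1 - f j - u j.+1) by ring.
  rewrite (le_trans (ler_normD _ _))// !normrM (ger0_norm p0) (ger0_norm q0).
  have -> : e = (1 - p) * e + p * e by ring.
  by rewrite lerD// ler_wpM2l.
move=> he /(_ he).
move: (bernE ps f) (bernE ps (fun j => f j.+1)).
move: (bernE ps u) (bernE ps (fun j => u j.+1)).
move: (bernE ps (fun j => (j%:R - m) * f j)).
move: (bernE ps (fun j => (j%:R - m) * f j.+1)).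
move=> y x c d a b h1 h2 h3.
set lhs := (X in `|X| <= _).
(* Conditioning on the new variable: the induction hypotheses for [f] and for its shift enter with
   weights [1 - p] and [p]; the last term is the contribution of the new variable itself. *)
have -> : lhs = (1 - p) * (x - v * c) + p * (y - v * d) +
   p * (1 - p) * (b - a - ((1 - p) * c + p * d)) by rewrite /lhs; ring.
have -> : (p * (1 - p) + v) * e =
   (1 - p) * (v * e) + p * (v * e) + p * (1 - p) * e by ring.
rewrite (le_trans (ler_normD _ _))// lerD//.
  rewrite (le_trans (ler_normD _ _))// !normrM (ger0_norm p0) (ger0_norm q0).
  by rewrite lerD// ler_wpM2l.
rewrite normrM ger0_norm ?mulr_ge0 ?subr_ge0//.
by rewrite ler_wpM2l// mulr_ge0 ?subr_ge0.
Qed.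

(** [bernE_covariance] is exact ([e = 0]) for affine functions: slope 1 gives the variance, and the
    constant 1 shows that [bern_mean] is the mean. *)
Lemma bernE_sqr ps (m : R) : prob_seq ps ->
  bernE ps (fun j => (j%:R - m) ^+ 2) = bern_var ps + (bern_mean ps - m) ^+ 2.
Proof.
move=> hps.
have := @bernE_covariance ps (fun j => j%:R - m) (fun=> 1) 0 hps.
have h j : `|j.+1%:R - m - (j%:R - m) - 1| <= 0 :> R.
  by rewrite normr_le0 -natr1; apply/eqP; ring.
rewrite bernE_cst mulr1 mulr0 normr_le0 subr_eq0 => /(_ h h)/eqP cov.
have := @bernE_covariance ps (fun j => 1) (fun=> 0) 0 hps.
have h' (j : nat) : `|1 - 1 - 0| <= 0 :> R by rewrite !subrr normr0.
move=> /(_ h' h'); rewrite bernE_cst !mulr0 subr0 normr_le0 => /eqP mean.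
have -> : bernE ps (fun j => (j%:R - m) ^+ 2) =
  bernE ps (fun j => (j%:R - bern_mean ps) * (j%:R - m)) +
  (bern_mean ps - m) *
    bernE ps (fun j => (j%:R - bern_mean ps) * 1 + (bern_mean ps - m)).
  by rewrite -bernEZ -bernED; apply: eq_bernE => j; ring.
by rewrite cov bernED mean bernE_cst; ring.
Qed.

Definition stdz (m s : R) (j : nat) : R := (j%:R - m) / s.

(** [bernE_covariance] is applied to [F] at the standardized points, with [u] equal to [F' / s]
    there. By the mean value theorem each increment is [F' y / s] for an intermediate [y], so the
    error is at most [L / s ^+ 2]. The three terms of the bound come from the variance mismatch,
    this discretisation, and the mean mismatch. *)
Lemma bernE_stein ps (m s : R) (F F' : R -> R) (M M' L : R) :
  prob_seq ps -> 0 < s ->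
  (forall x : R, is_derive x 1 F (F' x)) ->
  (forall x, `|F x| <= M) -> (forall x, `|F' x| <= M') ->
  (forall x y, `|F' x - F' y| <= L * `|x - y|) ->
  `|bernE ps (fun j => F' (stdz m s j) - stdz m s j * F (stdz m s j))| <=
    `|bern_var ps / s ^+ 2 - 1| * M' + bern_var ps / s ^+ 2 * (L / s)
      + `|(bern_mean ps - m) / s| * M.
Proof.
move=> hps s0 dF FM F'M' F'L; set w := stdz m s.
have L0 : 0 <= L by have := F'L 1 0; rewrite subr0 normr1 mulr1; apply: le_trans.
have wS j : w j.+1 = w j + s^-1 by rewrite /w /stdz -natr1; field; rewrite gt_eqF.
have incr j x : `|x - w j| <= s^-1 -> `|x - w j.+1| <= s^-1 -> 
   forall y, w j <= y <= w j.+1 -> `|F' y - F' x| <= L / s.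
  rewrite wS => h1 h2 y hy; rewrite (le_trans (F'L _ _))// ler_wpM2l//.
  move: h1 h2; rewrite !ler_norml => /andP[? ?] /andP[? ?].
  by move/andP: hy => [? ?]; apply/andP; split; lra.
have si0 : 0 < s^-1 by rewrite invr_gt0.
have mvt j : exists2 y, w j <= y <= w j.+1 & F (w j.+1) - F (w j) = F' y / s.
  have ltw : w j < w j.+1 by rewrite wS ltrDl.
  have [|y] := @MVT R F F' _ _ ltw (fun x _ => dF x).
    by apply: derivable_within_continuous => x _; exact: ex_derive.
  rewrite in_itv/= => /andP[y1 y2] ->; exists y; first by rewrite !ltW.
  by rewrite wS addrAC subrr add0r.
have step j x : `|x - w j| <= s^-1 -> `|x - w j.+1| <= s^-1 ->
   `|F (w j.+1) - F (w j) - F' x / s| <= L / s / s.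
  move=> h1 h2; have [y hy ->] := mvt j.
  rewrite -mulrBl normrM [X in _ * X]gtr0_norm//.
  by apply: ler_wpM2r; [exact: ltW|exact: (incr j x)].
have := @bernE_covariance ps
  (fun j => F (w j)) (fun j => F' (w j) / s) (L / s / s) hps.
have h1 j : `|F (w j.+1) - F (w j) - F' (w j) / s| <= L / s / s.
  apply: step; first by rewrite subrr normr0 ltW.
  by rewrite wS opprD addrA subrr add0r normrN gtr0_norm.
have h2 j : `|F (w j.+1) - F (w j) - F' (w j.+1) / s| <= L / s / s.
  apply: step; last by rewrite subrr normr0 ltW.
  by rewrite wS addrAC subrr add0r gtr0_norm.
move=> /(_ h1 h2).
have -> : bernE ps (fun j => F' (w j) / s) = s^-1 * bernE ps (fun j => F' (w j)).
  by rewrite -bernEZ; apply: eq_bernE => j; rewrite mulrC.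
have -> : bernE ps (fun j => F' (w j) - w j * F (w j)) =
   bernE ps (fun j => F' (w j))
    - s^-1 * bernE ps (fun j => (j%:R - bern_mean ps) * F (w j))
    - (bern_mean ps - m) / s * bernE ps (fun j => F (w j)).
  rewrite -!bernEZ -!bernEB; apply: eq_bernE => j.
  by rewrite [X in _ - X * _]/w /stdz; ring.
have := bernE_norm_le hps (fun j => FM (w j)).
have := bernE_norm_le hps (fun j => F'M' (w j)).
move: (bernE ps (fun j => F (w j))) (bernE ps (fun j => F' (w j))).
move: (bernE ps _) => D EF EF' hEF' hEF hD.
set mm := (bern_mean ps - m) / s; set v := bern_var ps in hD *.
have -> : EF' - s^-1 * D - mm * EF =
   - ((v / s ^+ 2 - 1) * EF') - s^-1 * (D - v * (s^-1 * EF')) - mm * EF.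
  by field; rewrite gt_eqF.
rewrite (le_trans (ler_normB _ _))// lerD//; last by rewrite normrM ler_wpM2l.
rewrite (le_trans (ler_normB _ _))// lerD//; first by rewrite normrN normrM ler_wpM2l.
rewrite normrM gtr0_norm//.
have -> : v / s ^+ 2 * (L / s) = s^-1 * (v * (L / s / s)) by field; rewrite gt_eqF.
by rewrite ler_wpM2l// ltW.
Qed.

End bernE_theory.

(** * Harmonic sums with shift [c] *)

Section shifted_harmonic.
Context {R : realType} (c : R).
Hypothesis c0 : 0 < c.

Let cn_gt0 n : 0 < c + n%:R.
Proof. by rewrite ltr_wpDr. Qed.

Lemma ln_succ_le (x : R) : 0 < x -> ln (x + 1) - ln x <= x^-1.
Proof.
move=> x0; rewrite -ln_div ?posrE ?addr_gt0// mulrDl divff ?gt_eqF// mul1r.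
by rewrite le_ln1Dx// (lt_trans _ (_ : 0 < x^-1)) ?invr_gt0// oppr_lt0.
Qed.

Lemma ln_succ_ge (x : R) : 0 < x -> (x + 1)^-1 <= ln (x + 1) - ln x.
Proof.
move=> x0; have x10 : 0 < x + 1 by rewrite addr_gt0.
rewrite -lerN2 opprB -ln_div ?posrE//.
have -> : x / (x + 1) = 1 + - (x + 1)^-1 by field; rewrite gt_eqF.
by rewrite le_ln1Dx// ltrN2 invf_lt1// ltrDr.
Qed.

Lemma shifted_harmonic_ge n :
  ln (c + n%:R) - ln c <= \sum_(i < n) (c + i%:R)^-1.
Proof.
elim: n => [|n IHn]; first by rewrite big_ord0 addr0 subrr.
rewrite big_ord_recr /= -natr1 addrA.
have := ln_succ_le (cn_gt0 n); lra.
Qed.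

Lemma shifted_harmonic_le n :
  \sum_(i < n) (c + i%:R)^-1 <= c^-1 + (ln (c + n%:R) - ln c).
Proof.
have ci : 0 < c^-1 by rewrite invr_gt0.
have le_succ m : \sum_(i < m.+1) (c + i%:R)^-1 <= c^-1 + (ln (c + m%:R) - ln c).
  elim: m => [|m IHm]; first by rewrite big_ord_recl big_ord0 !addr0 subrr addr0.
  rewrite big_ord_recr /= -natr1 addrA.
  have := ln_succ_ge (cn_gt0 m); lra.
case: n => [|n]; first by rewrite big_ord0 addr0 subrr addr0 ltW.
apply: le_trans (le_succ n) _; rewrite lerD2l lerD2r ler_ln ?posrE//.
by rewrite lerD2l ler_nat.
Qed.

Lemma shifted_harmonic_ln : exists K : R, forall n, (0 < n)%N ->
  `|\sum_(i < n) (c + i%:R)^-1 - ln n%:R| <= K.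
Proof.
(* [c^-1] is the first term of the sum, [c] bounds [ln (1 + c / n)], and the logarithm of [c] comes
   from the telescoped integral bounds. *)
exists (c^-1 + c + `|ln c|) => n n0.
have nR0 : 0 < n%:R :> R by rewrite ltr0n.
have ci : 0 < c^-1 by rewrite invr_gt0.
have h1 : ln n%:R <= ln (c + n%:R) by rewrite ler_ln ?posrE// lerDr ltW.
have h2 : ln (c + n%:R) - ln n%:R <= c.
  rewrite -ln_div ?posrE// mulrDl divff ?gt_eqF// addrC.
  apply: (@le_trans _ _ (c / n%:R)).
    by rewrite le_ln1Dx// (lt_trans _ (_ : 0 < c / n%:R)) ?divr_gt0// oppr_lt0.
  by rewrite ler_pdivrMr// ler_peMr ?ler1n//; exact: ltW.
have h3 := shifted_harmonic_ge n; have h4 := shifted_harmonic_le n.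
have h5 := ler_norm (ln c); have h6 := ler_norm (- ln c); rewrite normrN in h6.
by rewrite ler_norml; apply/andP; split; lra.
Qed.

(** Telescoping: the square of [(x + 1)^-1] is at most [x^-1 - (x + 1)^-1]. The induction carries
    the remaining term [- (c + n%:R)^-1]. *)
Lemma sum_shifted_sqr_le n :
  \sum_(i < n) (c + i%:R)^-1 ^+ 2 <= c^-1 ^+ 2 + c^-1.
Proof.
have ci : 0 < c^-1 by rewrite invr_gt0.
suff : \sum_(i < n.+1) (c + i%:R)^-1 ^+ 2 <= c^-1 ^+ 2 + c^-1 - (c + n%:R)^-1.
  have i0 : 0 < (c + n%:R)^-1 by rewrite invr_gt0.
  have := sqr_ge0 (c + n%:R)^-1.
  rewrite big_ord_recr /=; lra.
elim: n => [|m IHm].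
  by rewrite big_ord_recl big_ord0 !addr0 addrK.
rewrite big_ord_recr /= -natr1 addrA; set x := c + m%:R in IHm *.
have x0 : 0 < x := cn_gt0 m.
have x10 : 0 < x + 1 by rewrite addr_gt0.
have : (x + 1)^-1 ^+ 2 <= x^-1 - (x + 1)^-1.
  have -> : x^-1 - (x + 1)^-1 = x^-1 * (x + 1)^-1.
    by field; rewrite !gt_eqF.
  rewrite expr2 ler_wpM2r ?invr_ge0 ?(ltW x10)//.
  by rewrite lef_pV2 ?posrE// lerDl.
lra.
Qed.

End shifted_harmonic.

Lemma cvg_ln_nat (R : realType) : ln n%:R @[n --> \oo] --> (+oo : set_system R).
Proof.
apply/cvgryPge => A; near=> n.
rewrite -[A]expRK ler_ln ?posrE ?expR_gt0//.
  by near: n; exact: nbhs_infty_ger.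
by rewrite ltr0n; near: n; exact: nbhs_infty_gt.
Unshelve. all: by end_near. Qed.

(** * Asymptotics of the Bernoulli parameters and of the total variation bound *)

Section rlah_asymptotics.
Context {R : realType} (k : nat) (r : R).
Hypotheses (r0 : 0 <= r) (kr0 : 0 < k%:R + r).
Let theta : R := k%:R + r.
Let c : R := theta + r.
Let c0 : 0 < c. Proof. by rewrite ltr_wpDr. Qed.

Lemma rlah_ps_prob n : prob_seq (rlah_ps k r n).
Proof.
apply/allP => _ /mapP[i _ ->]; rewrite -/theta addrA -/c.
have ci0 : 0 < c + i%:R by rewrite ltr_wpDr.
rewrite divr_ge0 ?(ltW kr0) ?(ltW ci0)//= ler_pdivrMr// mul1r /c -addrA lerDl.
by rewrite addr_ge0.
Qed.

Lemma rlah_ps_mean : exists K : R, forall n, (0 < n)%N ->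
  `|bern_mean (rlah_ps k r n) - theta * ln n%:R| <= K.
Proof.
have [K hK] := shifted_harmonic_ln c0; exists (theta * K) => n n0.
rewrite /bern_mean big_map big_mkord -/theta.
under eq_bigr do rewrite addrA -/c.
by rewrite -mulr_sumr -mulrBr normrM gtr0_norm// ler_wpM2l ?hK// ltW.
Qed.

(** The variance is the mean minus the sum of the squared parameters, and that sum stays bounded. *)
Lemma rlah_ps_var : exists K : R, forall n, (0 < n)%N ->
  `|bern_var (rlah_ps k r n) - theta * ln n%:R| <= K.
Proof.
have [K hK] := rlah_ps_mean.
exists (K + theta ^+ 2 * (c^-1 ^+ 2 + c^-1)) => n n0.
have -> : bern_var (rlah_ps k r n) = bern_mean (rlah_ps k r n) -
    theta ^+ 2 * \sum_(i < n) (c + i%:R)^-1 ^+ 2.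
  rewrite /bern_mean /bern_var !big_map !big_mkord mulr_sumr -sumrB.
  by apply: eq_bigr => i _; rewrite -/theta addrA -/c; ring.
rewrite addrAC (le_trans (ler_normB _ _))// lerD ?hK//.
rewrite ger0_norm; first by rewrite ler_wpM2l ?sqr_ge0// sum_shifted_sqr_le.
by rewrite mulr_ge0 ?sqr_ge0 ?sumr_ge0// => i _; rewrite sqr_ge0.
Qed.

(** Each factor is [1 - (c - x) / (c + m)], at most the exponential of [- (c - x) / (c + m)], and
    the harmonic sum in the exponent diverges. *)
Lemma prod_ratio_cvg0 (x : R) : 0 <= x < c ->
  \prod_(m < n) ((x + m%:R) / (c + m%:R)) @[n --> \oo] --> (0 : R).
Proof.
move=> /andP[x0 xc].
apply: (@squeeze_cvgr _ _ _ _ (fun=> 0)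
  (fun n => expR (- ((c - x) * (ln n%:R - ln c))))).
- near=> n; have n0 : (0 < n)%N by near: n; exact: nbhs_infty_gt.
  apply/andP; split.
    by apply: prodr_ge0 => i _; rewrite divr_ge0 ?addr_ge0// ltW.
  apply: (@le_trans _ _ (expR (\sum_(m < n) - ((c - x) * (c + m%:R)^-1)))).
    rewrite expR_sum; apply: ler_prod => i _.
    have ci0 : 0 < c + i%:R by rewrite ltr_wpDr.
    rewrite divr_ge0 ?(ltW ci0) ?addr_ge0//=.
    apply: le_trans (expR_ge1Dx _).
    by rewrite le_eqVlt; apply/orP; left; apply/eqP; field; rewrite gt_eqF.
  rewrite ler_expR sumrN lerN2 -mulr_sumr ler_wpM2l ?subr_ge0 ?(ltW xc)//.
  apply: le_trans (shifted_harmonic_ge c0 n); rewrite lerD2r ler_ln ?posrE ?ltr0n//.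
    by rewrite lerDr ltW.
  by rewrite ltr_wpDr.
- exact: cvg_cst.
- apply: (cvg_comp (fun n => (c - x) * (ln n%:R - ln c)) (fun y => expR (- y)));
    last exact: cvgr_expR.
  apply/cvgryPge => A; near=> n.
  rewrite -ler_pdivrMl ?subr_gt0// lerBrDr.
  by near: n; move/cvgryPge: (@cvg_ln_nat R); apply.
Unshelve. all: by end_near. Qed.

Lemma lah_gap_cvg0 : lah_gap k r n @[n --> \oo] --> (0 : R).
Proof.
rewrite /lah_gap.
have e0 : \sum_(i < k) 'C(k, i)%:R * 0 = 0 :> R.
  by rewrite big1// => i; rewrite mulr0.
rewrite -[X in _ --> X]e0.
apply: cvg_big => [|i _]; first exact: add_continuous.
apply: cvgM; first exact: cvg_cst.
under eq_fun do under eq_bigr do rewrite !addrA.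
apply: prod_ratio_cvg0; rewrite !addr_ge0//= /c /theta.
by rewrite !ltrD2r ltr_nat.
Qed.

End rlah_asymptotics.

(** * Stein's equation for the normal law *)

Definition lipschitz_by (R : realType) (K : R) (f : R -> R) :=
  forall x y, `|f x - f y| <= K * `|x - y|.

Lemma lipschitz_by_ge0 (R : realType) (K : R) f : lipschitz_by K f -> 0 <= K.
Proof.
by move=> fK; have := fK 1 0; rewrite subr0 normr1 mulr1; exact: le_trans.
Qed.

Lemma lipschitz_by_continuous (R : realType) (K : R) (f : R -> R) :
  lipschitz_by K f -> continuous f.
Proof.
move=> fK x; have K0 := lipschitz_by_ge0 fK.
apply/cvgrPdist_le => /= e e0; near=> y.
apply: le_trans (fK _ _) _.
apply: (@le_trans _ _ ((K + 1) * `|x - y|)).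
  by rewrite ler_wpM2r// lerDl.
rewrite -ler_pdivlMl ?ltr_wpDl//; near: y.
by apply: cvgr_dist_le; [exact: cvg_id|rewrite mulr_gt0// invr_gt0 ltr_wpDl].
Unshelve. all: by end_near. Qed.

Lemma derive_lipschitz_by (R : realType) (f df : R -> R) (K : R) :
  (forall x : R, is_derive x 1 f (df x)) -> (forall x, `|df x| <= K) ->
  lipschitz_by K f.
Proof.
move=> dfx dfK x y.
wlog xy : x y / x <= y => [hwlog|].
  by have [/hwlog//|/ltW/hwlog] := leP x y; rewrite distrC (distrC x).
have cf : {within `[x, y], continuous f}.
  by apply: derivable_within_continuous => z _; exact: ex_derive.
have [z _ fyx] := @MVT_segment R f df x y xy (fun z _ => dfx z) cf.
by rewrite distrC fyx normrM (distrC x) ler_wpM2r.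
Qed.

Section normal_expectation.
Context {R : realType}.
Implicit Types (f g h : R -> R).
Notation mu := (@lebesgue_measure R).
Notation phi := (normal_pdf (0 : R) 1).

Definition normal_exp h : R := \int[mu]_x (h x * phi x).

Lemma integrable_normal h (M : R) : measurable_fun setT h ->
  (forall x, `|h x| <= M) ->
  mu.-integrable setT (EFin \o (fun x => h x * phi x)).
Proof.
move=> mh hM.
have -> : EFin \o (fun x => h x * phi x) = ((EFin \o h) \* (fun x => (phi x)%:E))%E.
  by apply/funext => x /=; rewrite EFinM.
apply: integrableMr => //; last exact: integrable_normal_pdf.
exists M; split; first exact: num_real.
by move=> N MN x _; apply: le_trans (hM x) (ltW MN).
Qed.

Lemma normal_exp_cst (c : R) : normal_exp (fun=> c) = c.
Proof.
rewrite /normal_exp RintegralZl//; last exact: integrable_normal_pdf.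
by rewrite /Rintegral integral_normal_pdf mulr1.
Qed.

Lemma le_normal_exp f g (M : R) :
  measurable_fun setT f -> measurable_fun setT g ->
  (forall x, `|f x| <= M) -> (forall x, `|g x| <= M) ->
  (forall x, f x <= g x) -> normal_exp f <= normal_exp g.
Proof.
move=> mf mg fM gM fg; apply: le_Rintegral => //.
- exact: integrable_normal fM.
- exact: integrable_normal gM.
- by move=> x _; rewrite ler_wpM2r// normal_pdf_ge0.
Qed.

Lemma normal_exp_norm_le f (M : R) : measurable_fun setT f ->
  (forall x, `|f x| <= M) -> `|normal_exp f| <= M.
Proof.
move=> mf fM; rewrite ler_norml -{1}(normal_exp_cst (- M)) -{2}(normal_exp_cst M).
have M0 : 0 <= M by apply: le_trans (fM 0).
by apply/andP; split; apply: (@le_normal_exp _ _ M) => // x;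
  rewrite ?normrN ?ger0_norm//; have := fM x; rewrite ler_norml => /andP[].
Qed.

Lemma normal_expB f g (M : R) :
  measurable_fun setT f -> measurable_fun setT g ->
  (forall x, `|f x| <= M) -> (forall x, `|g x| <= M) ->
  normal_exp (fun x => f x - g x) = normal_exp f - normal_exp g.
Proof.
move=> mf mg fM gM; rewrite /normal_exp -RintegralB//.
- by apply: eq_Rintegral => x _; rewrite mulrBl.
- exact: integrable_normal fM.
- exact: integrable_normal gM.
Qed.

Lemma normal_expZ (c : R) f (M : R) :
  measurable_fun setT f -> (forall x, `|f x| <= M) ->
  normal_exp (fun x => c * f x) = c * normal_exp f.
Proof.
move=> mf fM; rewrite /normal_exp -RintegralZl//; last exact: integrable_normal fM.
by apply: eq_Rintegral => x _; rewrite mulrA.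
Qed.

Let peak : R := normal_peak 1.
Let peak0 : peak != 0. Proof. by rewrite gt_eqF// normal_peak_gt0. Qed.
(** The reciprocal of the normal density, used to solve the linear equation [F' - x F = g]
    explicitly. *)
Let E (x : R) : R := peak^-1 * expR (x ^+ 2 / 2).

Let phiE x : phi x * E x = 1.
Proof.
rewrite normal_pdfE// /E /normal_fun subr0 expr1n mulrACA divff// mul1r.
by rewrite -expRD mulNr addrC subrr expR0.
Qed.

Let E_gt0 x : 0 < E x.
Proof. by rewrite mulr_gt0 ?expR_gt0// invr_gt0 normal_peak_gt0. Qed.

Let dE (x : R) : is_derive x 1 E (x * E x).
Proof.
have -> : E = peak^-1 *: (expR \o (2^-1 *: ((@idfun R : R -> R) ^+ 2))).
  apply/funext => y; rewrite /E !fctE /=.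
  by rewrite [_ / 2]mulrC.
apply: is_derive_eq.
rewrite /E !fctE /= expr1 /GRing.scale /= !mulr1.
by field.
Qed.

(** The solution is the integral of [g * phi] up to [x], divided by [phi x]. Compact support and
    mean zero make it vanish for [B <= |x|], so all bounds reduce to the interval [-B, B]. *)
Lemma stein_solution g (K M B : R) : 0 <= B -> lipschitz_by K g ->
  (forall x, `|g x| <= M) -> (forall x, B <= `|x| -> g x = 0) ->
  normal_exp g = 0 ->
  exists (F F' : R -> R) (C : R), [/\ (forall x : R, is_derive x 1 F (F' x)),
    (forall x, `|F x| <= C), (forall x, `|F' x| <= C), lipschitz_by C F' &
    (forall x, F' x - x * F x = g x)].
Proof.
move=> B0 gK gM gB g0.
have M0 : 0 <= M by apply: le_trans (gM 0).
have cg := lipschitz_by_continuous gK.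
have mg := continuous_measurable_fun cg.
have cphi : continuous phi by exact: continuous_normal_pdf.
pose gphi x := g x * phi x.
have igphi : mu.-integrable setT (EFin \o gphi) by exact: integrable_normal gM.
have igphiS D : measurable D -> mu.-integrable D (EFin \o gphi).
  by move=> mD; apply: integrableS igphi.
pose G x := \int[mu]_(t in `]-oo, x]) gphi t.
have dG (x : R) : is_derive x 1 G (gphi x).
  have xx1 : x < x + 1 by rewrite ltrDl.
  have cgphi : {for x, continuous gphi}.
    by apply: cvgM; [exact: cg|exact: cphi].
  have igphix : mu.-integrable `]-oo, x + 1] (EFin \o gphi) by exact: igphiS.
  have [dGx <-] := @continuous_FTC1 R gphi -oo%O x (x + 1) xx1 igphix (ltNyr x) cgphi.
  by rewrite derive1E; exact: derivableP.
(* To the right of the support the integral is the full Gaussian mean, which is 0; to the left the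
   integrand vanishes. *)
have G0 x : B <= `|x| -> G x = 0.
  move=> Bx; rewrite /G; have [x0|x0] := leP 0 x.
    rewrite Rintegral_mkcond -[RHS]g0 /normal_exp; apply: eq_Rintegral => t _.
    rewrite patchE; case: ifPn => //; rewrite notin_setE/= in_itv/= => /negP.
    rewrite -ltNge => xt; rewrite gB ?mul0r//.
    have t0 : 0 <= t := le_trans x0 (ltW xt).
    by rewrite (le_trans Bx)// (ger0_norm x0) (ger0_norm t0) ltW.
  rewrite /Rintegral integral0_eq// => t /=; rewrite in_itv/= => tx.
  have t0 : t < 0 := le_lt_trans tx x0.
  rewrite /gphi gB ?mul0r//.
  by rewrite (le_trans Bx)// (ltr0_norm x0) (ltr0_norm t0) lerN2.
have GM x : `|G x| <= M.
  have -> : G x = normal_exp (g \_ `]-oo, x]).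
    rewrite /G Rintegral_mkcond; apply: eq_Rintegral => t _.
    by rewrite /= !patchE; case: ifP; rewrite ?mul0r.
  apply: normal_exp_norm_le => [|t].
    by apply/(measurable_restrictT _ _).1 => //; exact: measurable_funS mg.
  by rewrite patchE; case: ifP => _ //; rewrite normr0.
(* [F'] is defined by Stein's equation; what has to be checked is that it is the derivative of
   [F]. *)
pose F x := G x * E x; pose F' x := g x + x * F x.
have dF (x : R) : is_derive x 1 F (F' x).
  rewrite (_ : F = G * E); last exact/funext.
  apply: is_derive_eq.
  rewrite /F' /F /gphi /GRing.scale/=.
  have -> : E x * (g x * phi x) = g x * (phi x * E x) by ring.
  by rewrite phiE /E; field.
have F0 x : B <= `|x| -> F x = 0 by move=> Bx; rewrite /F G0 ?mul0r.
have FM x : `|F x| <= M * E B.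
  have [Bx|xB] := leP B `|x|.
    by rewrite F0// normr0 mulr_ge0// ltW.
  rewrite normrM (gtr0_norm (E_gt0 x)) ler_pM// ?(ltW (E_gt0 x))//.
  rewrite ler_wpM2l ?invr_ge0 ?normal_peak_ge0// ler_expR ler_wpM2r ?invr_ge0//.
  by rewrite -[leLHS]real_normK ?num_real// ler_sqr ?nnegrE// ltW.
pose MF := M * E B.
have MF0 : 0 <= MF by rewrite mulr_ge0// ltW.
have F'M x : `|F' x| <= M + B * MF.
  rewrite (le_trans (ler_normD _ _))// lerD//.
  have [Bx|xB] := leP B `|x|; first by rewrite F0// mulr0 normr0 mulr_ge0.
  by rewrite normrM ler_pM// ltW.
have F'0 x : B <= `|x| -> F' x = 0.
  by move=> Bx; rewrite /F' gB// F0// mulr0 addr0.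
(* [K] accounts for [g]; the rest bounds the derivative [F x + x * F' x] of [x * F x]. *)
pose L := K + (MF + B * (M + B * MF)).
have K0 := lipschitz_by_ge0 gK.
have F'L : lipschitz_by L F'.
  have idF : lipschitz_by (MF + B * (M + B * MF)) (fun x => x * F x).
    apply: (@derive_lipschitz_by _ _ (fun x => F x + x * F' x)) => x.
      rewrite (_ : (fun x => x * F x) = (@idfun R : R -> R) * F); last exact/funext.
      apply: is_derive_eq.
      by rewrite /GRing.scale/= mulr1 addrC.
    rewrite (le_trans (ler_normD _ _))// lerD//.
    have [Bx|xB] := leP B `|x|.
      by rewrite F'0// mulr0 normr0 mulr_ge0// addr_ge0// mulr_ge0.
    by rewrite normrM ler_pM// ltW.
  move=> x y; rewrite /F' opprD addrACA (le_trans (ler_normD _ _))//.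
  by rewrite /L mulrDl lerD.
exists F, F', (MF + (M + B * MF) + L).
have MB0 : 0 <= M + B * MF by rewrite addr_ge0// mulr_ge0.
have L0 : 0 <= L by rewrite /L !addr_ge0// mulr_ge0.
split=> //.
- by move=> x; apply: le_trans (FM x) _; rewrite -addrA lerDl addr_ge0.
- by move=> x; apply: le_trans (F'M x) _; rewrite addrAC lerDr addr_ge0.
- by move=> x y; apply: le_trans (F'L x y) _; rewrite ler_wpM2r// lerDr addr_ge0.
- by move=> x; rewrite /F' addrK.
Qed.

End normal_expectation.

(** * Central limit theorem *)

Section cutoffs.
Context {R : realType}.
Implicit Types (a d A t x y : R).

Definition clamp t : R := if t <= 0 then 0 else if 1 <= t then 1 else t.

Lemma clamp_itv t : 0 <= clamp t <= 1.
Proof. by rewrite /clamp; case: (leP t 0) => ?; case: (leP 1 t) => ?; lra. Qed.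

Lemma clamp_le0 t : t <= 0 -> clamp t = 0.
Proof. by rewrite /clamp; case: (leP t 0) => ?; case: (leP 1 t) => ? ?; lra. Qed.

Lemma clamp_ge1 t : 1 <= t -> clamp t = 1.
Proof. by rewrite /clamp; case: (leP t 0) => ?; case: (leP 1 t) => ? ?; lra. Qed.

Lemma clamp_lipschitz s t : `|clamp s - clamp t| <= `|s - t|.
Proof.
have h u v : u <= v -> 0 <= clamp v - clamp u <= v - u.
  rewrite /clamp; case: (leP u 0) => ?; case: (leP v 0) => ?;
  by case: (leP 1 u) => ?; case: (leP 1 v) => ? ?; lra.
have [/h|/ltW/h] := leP s t => /andP[h1 h2].
  by rewrite distrC (distrC s) (ger0_norm h1) (le_trans h2)// ler_norm.
by rewrite (ger0_norm h1) (le_trans h2)// ler_norm.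
Qed.

(** For [d > 0], a Lipschitz version of the indicator of [y <= a] that descends linearly to 0 on
    [a, a + d]. *)
Definition ramp a d y : R := clamp ((a + d - y) / d).

(** For [A >= 0], a trapezoid that is 1 on [-A, A] and 0 outside [-A - 1, A + 1]; it supplies the
    compact support that [stein_solution] asks for. *)
Definition bump A y : R := clamp (A + 1 - `|y|).

Lemma ramp_lipschitz a d : 0 < d -> lipschitz_by d^-1 (ramp a d).
Proof.
move=> d0 x y; apply: le_trans (clamp_lipschitz _ _) _.
rewrite -mulrBl normrM (@gtr0_norm _ d^-1) ?invr_gt0// mulrC.
by rewrite (_ : a + d - x - (a + d - y) = y - x) 1?distrC//; ring.
Qed.

Lemma le_ramp a d y : 0 < d -> (y <= a)%R%:R <= ramp a d y.
Proof.
move=> d0; case: (leP y a) => ya /=; last first.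
  by case/andP: (clamp_itv ((a + d - y) / d)).
by rewrite /ramp clamp_ge1// ler_pdivlMr// mul1r; lra.
Qed.

Lemma ramp_le a d y : 0 < d -> ramp a d y <= (y <= a + d)%R%:R.
Proof.
move=> d0; case: (leP y (a + d)) => ya /=.
  by case/andP: (clamp_itv ((a + d - y) / d)).
by rewrite /ramp clamp_le0// pmulr_lle0 ?invr_gt0//; lra.
Qed.

Lemma bump_lipschitz A : lipschitz_by 1 (bump A).
Proof.
move=> x y; apply: le_trans (clamp_lipschitz _ _) _; rewrite mul1r.
rewrite (_ : A + 1 - `|x| - (A + 1 - `|y|) = `|y| - `|x|); last by ring.
by rewrite (distrC x) ler_dist_dist.
Qed.

Lemma bump0 A y : A + 1 <= `|y| -> bump A y = 0.
Proof. by move=> Ay; rewrite /bump clamp_le0//; lra. Qed.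

Lemma bump1 A y : `|y| <= A -> bump A y = 1.
Proof. by move=> Ay; rewrite /bump clamp_ge1//; lra. Qed.

(** Pointwise form of Chebyshev's inequality: a second moment bound controls the mass lost by
    truncation. *)
Lemma one_minus_bump_le A y : 0 < A -> 1 - bump A y <= A ^- 2 * y ^+ 2.
Proof.
move=> A0; have [yA|Ay] := leP `|y| A.
  by rewrite bump1// subrr mulr_ge0 ?sqr_ge0// invr_ge0 sqr_ge0.
have /andP[b0 _] := clamp_itv (A + 1 - `|y|).
apply: (@le_trans _ _ 1); first by rewrite /bump; lra.
rewrite ler_pdivlMl ?exprn_gt0// mulr1 -[leRHS]real_normK ?num_real//.
by rewrite ler_sqr ?nnegrE ?(ltW A0) ?(ltW Ay).
Qed.

End cutoffs.

Lemma lipschitz_byM (R : realType) (K L : R) (f g : R -> R) :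
  lipschitz_by K f -> lipschitz_by L g ->
  (forall x, `|f x| <= 1) -> (forall x, `|g x| <= 1) ->
  lipschitz_by (K + L) (fun x => f x * g x).
Proof.
move=> fK gL f1 g1 x y.
have -> : f x * g x - f y * g y = (f x - f y) * g x + f y * (g x - g y) by ring.
rewrite (le_trans (ler_normD _ _))// !normrM mulrDl lerD//.
  by apply: le_trans (fK x y); rewrite ler_piMr.
by apply: le_trans (gL x y); rewrite ler_piMl.
Qed.

Lemma lipschitz_byB (R : realType) (K L : R) (f g : R -> R) :
  lipschitz_by K f -> lipschitz_by L g -> lipschitz_by (K + L) (fun x => f x - g x).
Proof.
move=> fK gL x y.
have -> : f x - g x - (f y - g y) = (f x - f y) - (g x - g y) by ring.
by rewrite (le_trans (ler_normB _ _))// mulrDl lerD.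
Qed.

Lemma lipschitz_byZ (R : realType) (K c : R) (f : R -> R) :
  lipschitz_by K f -> lipschitz_by (`|c| * K) (fun x => c * f x).
Proof. by move=> fK x y; rewrite -mulrBr normrM -mulrA ler_wpM2l. Qed.

Lemma normal_prob_indic (R : realType) (D : set (measurableTypeR R)) :
  measurable D -> normal_prob (0 : R) 1 D = (normal_exp (\1_D : R -> R))%:E.
Proof.
move=> mD; rewrite -[LHS]fineK ?fin_num_measure//; congr EFin.
rewrite /normal_exp /Rintegral /normal_prob [in LHS]integral_mkcond.
congr fine.
apply: eq_integral => x _; rewrite patchE indicE.
by case: ifP; rewrite ?mul1r ?mul0r.
Qed.

(** The intervals [-n, n] exhaust the line, so their Gaussian mass tends to 1, and the bump
    dominates their indicator. *)
Lemma normal_exp_bump_ge (R : realType) (e : R) : 0 < e ->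
  \forall n \near \oo, 1 - e <= normal_exp (@bump R n%:R).
Proof.
move=> e0.
pose D n : set (measurableTypeR R) := `[- n%:R, n%:R]%classic.
have mD n : measurable (D n) by exact: measurable_itv.
have := @nondecreasing_cvg_mu _ _ _ (normal_prob (0 : R) 1) D mD.
have -> : \bigcup_n D n = setT.
  apply/seteqP; split=> // x _.
  have [n xn] : exists n : nat, `|x| <= n%:R.
    by exists (Num.bound `|x|); rewrite ltW// archi_boundP.
  by exists n => //; rewrite /D /= in_itv/= -ler_norml.
move=> /(_ measurableT).
have ndD : nondecreasing_seq D.
  move=> m n mn; rewrite subsetEset => x; rewrite /D /= !in_itv/= -!ler_norml => xm.
  by rewrite (le_trans xm)// ler_nat.
move=> /(_ ndD) cvgDT.
have cvgD1 : normal_prob (0 : R) 1 (D n) @[n --> \oo] --> 1%:E.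
  by rewrite -(probability_setT (normal_prob (0 : R) 1)).
have := cvgr_ge _ (fine_cvg cvgD1) (1 - e).
rewrite ltrBlDr ltrDl => /(_ _ _ e0).
apply: filterS => n /=; rewrite normal_prob_indic//= => /le_trans; apply.
apply: (@le_normal_exp _ _ _ 1).
- exact: (measurable_indic (mD n)).
- exact: continuous_measurable_fun (lipschitz_by_continuous (bump_lipschitz _)).
- by move=> x; rewrite indicE; case: (_ \in _); rewrite ?normr1 ?normr0.
- by move=> x; have /andP[h1 h2] := clamp_itv (n%:R + 1 - `|x|); rewrite ger0_norm.
move=> x; rewrite indicE; case: (boolP (x \in _)) => [|_].
  by rewrite inE /D /= in_itv/= -ler_norml => xn; rewrite bump1.
by have /andP[] := clamp_itv (n%:R + 1 - `|x|).
Qed.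

(** * Limit theorem for triangular arrays of Bernoulli variables *)

Section bernoulli_clt.
Context {R : realType} (ps : nat -> seq R) (m s : nat -> R).
Hypothesis ps_prob : forall n, prob_seq (ps n).
Hypothesis s_gt0 : \forall n \near \oo, 0 < s n.
Hypothesis s_cvg : (s n)^-1 @[n --> \oo] --> (0 : R).
Hypothesis var_cvg : bern_var (ps n) / s n ^+ 2 @[n --> \oo] --> (1 : R).
Hypothesis mean_cvg :
  (bern_mean (ps n) - m n) / s n @[n --> \oo] --> (0 : R).

Definition bern_std (h : R -> R) n : R :=
  bernE (ps n) (fun j => h (stdz (m n) (s n) j)).

Lemma bern_std_stein (g : R -> R) (K M B : R) : 0 <= B -> lipschitz_by K g ->
  (forall x, `|g x| <= M) -> (forall x, B <= `|x| -> g x = 0) ->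
  normal_exp g = 0 -> bern_std g n @[n --> \oo] --> (0 : R).
Proof.
move=> B0 gK gM gB g0.
have [F [F' [C [dF FC F'C F'L FF']]]] := stein_solution B0 gK gM gB g0.
apply/norm_cvg0P.
pose bound n := `|bern_var (ps n) / s n ^+ 2 - 1| * C +
  bern_var (ps n) / s n ^+ 2 * (C / s n) + `|(bern_mean (ps n) - m n) / s n| * C.
apply: (@squeeze_cvgr _ _ _ _ (fun=> 0) bound).
- near=> n; rewrite normr_ge0/=.
  have sn0 : 0 < s n by near: n.
  apply: le_trans (bernE_stein (m n) (ps_prob n) sn0 dF FC F'C F'L).
  by rewrite (eq_bernE _ (g := fun j => g (stdz (m n) (s n) j))).
- exact: cvg_cst.
- have -> : 0 = `|1 - 1 : R| * C + 1 * (C * 0) + `|0 : R| * C.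
    by rewrite subrr normr0; ring.
  apply: cvgD; first apply: cvgD.
  + apply: cvgM; last exact: cvg_cst.
    by apply: cvg_norm; apply: cvgB => //; exact: cvg_cst.
  + by apply: cvgM => //; apply: cvgM => //; exact: cvg_cst.
  + by apply: cvgM; [exact: cvg_norm|exact: cvg_cst].
Unshelve. all: by end_near. Qed.

Lemma bern_std_sqr : \forall n \near \oo, bern_std (fun x => x ^+ 2) n <= 2.
Proof.
have c1 : bern_var (ps n) / s n ^+ 2 + ((bern_mean (ps n) - m n) / s n) ^+ 2
    @[n --> \oo] --> (1 : R).
  have -> : 1 = 1 + 0 * 0 :> R by ring.
  by apply: cvgD => //; under eq_fun do rewrite expr2; exact: cvgM.
have := cvgr_le _ c1 2; rewrite ltr1n => /(_ _ isT).
apply: filterS2 s_gt0 => n sn0; apply: le_trans.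
rewrite /bern_std (eq_bernE _ (g := fun j => (s n)^-2 * (j%:R - m n) ^+ 2)).
  rewrite bernEZ bernE_sqr// le_eqVlt; apply/orP; left; apply/eqP.
  by field; rewrite gt_eqF.
by move=> j; rewrite /stdz expr_div_n mulrC.
Qed.

(** Truncate [h] by a bump [chi] and subtract the multiple [c * chi] that makes the Gaussian mean 0;
    [bern_std_stein] applies to the difference. The mass outside the bump is small under both
    laws. *)
Lemma bern_std_cvg (h : R -> R) (K : R) : lipschitz_by K h ->
  (forall x, 0 <= h x <= 1) ->
  bern_std h n @[n --> \oo] --> normal_exp h.
Proof.
move=> hK h01.
have mh := continuous_measurable_fun (lipschitz_by_continuous hK).
have h1 x : `|h x| <= 1 by have /andP[? ?] := h01 x; rewrite ger0_norm.
apply/cvgrPdist_le => /= e e0.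
have e8 : 0 < e / 8 by rewrite divr_gt0.
(* The factor 2 is the second moment bound of [bern_std_sqr]. The minimum with 1/2 keeps the
   Gaussian mass of the bump away from 0, so that it can be divided by. *)
have [A [A1 Ae Ab]] : exists A : R, [/\ 1 <= A, A ^- 2 * 2 <= e / 8 &
    1 - Num.min (e / 8) 2^-1 <= normal_exp (bump A)].
  have min0 : 0 < Num.min (e / 8) 2^-1 by rewrite lt_min e8 /= invr_gt0.
  suff : \forall n \near \oo, [/\ 1 <= n%:R :> R, n%:R ^- 2 * 2 <= e / 8 &
      1 - Num.min (e / 8) 2^-1 <= normal_exp (@bump R n%:R)].
    by move/filter_ex => [n ?]; exists n%:R.
  near=> n; split.
  - by near: n; exact: nbhs_infty_ger.
  - have n1 : 1 <= n%:R :> R by near: n; exact: nbhs_infty_ger.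
    (* With [1 <= n] this gives [2 / n ^ 2 <= 2 / n <= e / 8]. *)
    have ne : 16 / e <= n%:R by near: n; exact: nbhs_infty_ger.
    have n0 : 0 < n%:R :> R by apply: lt_le_trans n1.
    rewrite ler_pdivrMl ?exprn_gt0//.
    move: ne; rewrite ler_pdivrMr// expr2 => ne.
    by have := ler_wpM2l (ltW (mulr_gt0 n0 e0)) n1; lra.
  - by near: n; exact: normal_exp_bump_ge.
have A0 : 0 < A by apply: lt_le_trans A1.
set chi := bump A.
have chi01 x : 0 <= chi x <= 1 by exact: clamp_itv.
have chi1 x : `|chi x| <= 1 by have /andP[? ?] := chi01 x; rewrite ger0_norm.
have lchi := @bump_lipschitz R A.
have mchi := continuous_measurable_fun (lipschitz_by_continuous lchi).
have lhchi := lipschitz_byM hK lchi h1 chi1.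
have mhchi := continuous_measurable_fun (lipschitz_by_continuous lhchi).
have hchi1 x : `|h x * chi x| <= 1 by rewrite normrM mulr_ile1.
pose Nc := normal_exp chi; pose Nh := normal_exp (fun x => h x * chi x).
have hchi_chi x : 0 <= h x * chi x <= chi x.
  have /andP[? ?] := chi01 x; have /andP[? ?] := h01 x.
  by rewrite mulr_ge0//= ler_piMl.
have Nc_ge : 1 - e / 8 <= Nc /\ 2^-1 <= Nc.
  have me : Num.min (e / 8) 2^-1 <= e / 8 by rewrite ge_min lexx.
  have m2 : Num.min (e / 8) 2^-1 <= 2^-1 by rewrite ge_min lexx orbT.
  by split; apply: le_trans Ab; lra.
have Nc0 : 0 < Nc by case: Nc_ge => _; apply: lt_le_trans.
have Nc1 : Nc <= 1.
  rewrite -(normal_exp_cst 1); apply: (@le_normal_exp _ _ _ 1) => //.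
    by move=> x; rewrite normr1.
  by move=> x; case/andP: (chi01 x).
have Nh0 : 0 <= Nh.
  rewrite -(normal_exp_cst 0); apply: (@le_normal_exp _ _ _ 1) => //.
    by move=> x; rewrite normr0.
  by move=> x; case/andP: (hchi_chi x).
have NhNc : Nh <= Nc.
  by apply: (@le_normal_exp _ _ _ 1) => // x; case/andP: (hchi_chi x).
have NhN : Nh <= normal_exp h <= Nh + (1 - Nc).
  have -> : 1 - Nc = normal_exp (fun x => 1 - chi x).
    by rewrite (@normal_expB _ _ _ 1) ?normal_exp_cst// => x; rewrite normr1.
  have c1M (x : R) : `|1 - chi x| <= 1.
    by have /andP[? ?] := chi01 x; rewrite ler_norml; lra.
  have hM (x : R) : `|h x - h x * chi x| <= 1.
    have := chi01 x; have := h01 x => /andP[? ?] /andP[? ?].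
    by rewrite ler_norml; nra.
  apply/andP; split.
    apply: (@le_normal_exp _ _ _ 1) => // x.
    by rewrite ler_piMr//; [case/andP: (h01 x)|case/andP: (chi01 x)].
  rewrite -lerBlDl -(@normal_expB _ _ _ 1)//.
  apply: (@le_normal_exp _ _ _ 1) => //.
  - exact: measurable_funB.
  - exact: measurable_funB.
  move=> x; have := chi01 x; have := h01 x => /andP[? ?] /andP[? ?]; nra.
pose c := Nh / Nc.
have c01 : 0 <= c <= 1 by rewrite /c divr_ge0 ?(ltW Nc0)//= ler_pdivrMr// mul1r.
have Nh_c : Nh = c * Nc by rewrite /c divfK// gt_eqF.
pose g x := h x * chi x - c * chi x.
have g_cvg : bern_std g n @[n --> \oo] --> (0 : R).
  apply: (@bern_std_stein g _ 2 (A + 1)).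
  - by rewrite addr_ge0// ltW.
  - exact: lipschitz_byB lhchi (lipschitz_byZ c lchi).
  - move=> x; rewrite (le_trans (ler_normB _ _))// (_ : 2 = 1 + 1)//.
    rewrite lerD// normrM; have /andP[? ?] := c01.
    by rewrite (ger0_norm (_ : 0 <= c))// mulr_ile1.
  - by move=> x Ax; rewrite /g /chi bump0// !mulr0 subrr.
  - rewrite /g (@normal_expB _ _ _ 1) ?(@normal_expZ _ _ _ 1)//.
    + by rewrite -/Nh -/Nc Nh_c subrr.
    + exact: measurable_funM.
    + move=> x; rewrite normrM; have /andP[? ?] := c01.
      by rewrite (ger0_norm (_ : 0 <= c))// mulr_ile1.
near=> n.
have hg : `|bern_std g n| <= e / 8.
  by near: n; move/cvgr0Pnorm_le : g_cvg; apply.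
have hsq : bern_std (fun x => x ^+ 2) n <= 2 by near: n; exact: bern_std_sqr.
have tail : bern_std (fun x => 1 - chi x) n <= e / 8.
  apply: le_trans Ae; apply: (@le_trans _ _ (A ^- 2 * bern_std (fun x => x ^+ 2) n)).
    rewrite /bern_std -bernEZ; apply: le_bernE => // j.
    exact: one_minus_bump_le.
  by rewrite ler_wpM2l// invr_ge0 sqr_ge0.
have EhC : bern_std (fun x => h x * chi x) n <= bern_std h n
    <= bern_std (fun x => h x * chi x) n + bern_std (fun x => 1 - chi x) n.
  rewrite /bern_std -bernED !le_bernE// => j; set x := stdz _ _ _.
    have := chi01 x; have := h01 x; nra.
  by have := chi01 x; have := h01 x; nra.
have tailE : bern_std (fun x => 1 - chi x) n = 1 - bern_std chi n.
  by rewrite /bern_std bernEB bernE_cst.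
have gE : bern_std g n = bern_std (fun x => h x * chi x) n - c * bern_std chi n.
  by rewrite /bern_std bernEB bernEZ.
have chi_le1 : bern_std chi n <= 1.
  rewrite -[leRHS](bernE_cst (ps n)); apply: le_bernE => // j.
  by case/andP: (chi01 (stdz (m n) (s n) j)).
(* Both expectations of [chi] lie in [1 - e / 8, 1], and [c] is at most 1. *)
have cdiff : `|c * (bern_std chi n - Nc)| <= e / 8.
  have /andP[? ?] := c01; rewrite normrM (ger0_norm (_ : 0 <= c))//.
  apply: (@le_trans _ _ `|bern_std chi n - Nc|); first by rewrite ler_piMl.
  by case: Nc_ge => ? _; rewrite ler_norml; lra.
case: Nc_ge => ? _.
move: hg cdiff; rewrite gE !ler_norml mulrBr -Nh_c => /andP[? ?] /andP[? ?].
move: EhC NhN; rewrite tailE => /andP[? ?] /andP[? ?].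
by apply/andP; split; lra.
Unshelve. all: by end_near. Qed.

End bernoulli_clt.

(** * Events of a random variable with prescribed point masses *)

Section discrete_law.
Context d (T : measurableType d) (R : realType) (P : probability T R).
Variables (X : {RV P >-> R}) (k n : nat) (p : nat -> R).
Hypothesis p_law : forall j, (k <= j <= n)%N -> P (X @^-1` [set j%:R]) = (p j)%:E.
Hypothesis sum_p : \sum_(k <= j < n.+1) p j = 1.

Let law_ge (E : set T) (b : nat -> bool) : measurable E ->
  (forall w j, X w = j%:R -> b j -> E w) ->
  ((\sum_(k <= j < n.+1) p j * (b j)%:R)%:E <= P E)%E.
Proof.
move=> mE bE.
pose F (j : 'I_n.+1) := X @^-1` [set j%:R].
have mF j : measurable (F j) by rewrite -[F j]setTI; exact: measurable_funP.
have tF : trivIset setT F.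
  move=> i j _ _ [w []]; rewrite /F /= => -> /eqP; rewrite eqr_nat => /eqP ij.
  exact: val_inj.
pose Q : {pred 'I_n.+1} := fun j => (k <= j)%N && b j.
have -> : \sum_(k <= j < n.+1) p j * (b j)%:R = \sum_(j < n.+1 | Q j) p j.
  rewrite (big_nat_widenl _ 0)// big_mkord [RHS]big_mkcondr/=.
  by apply: eq_bigr => j _; case: (b j); rewrite ?mulr1 ?mulr0.
rewrite -sumEFin (eq_bigr (fun j => P (F j))); last first.
  by move=> j /andP[kj _]; rewrite /F p_law// kj -ltnS ltn_ord.
rewrite -measure_bigsetU_ord//.
apply: le_measure; rewrite ?inE//; first exact: bigsetU_measurable.
apply: (big_ind (fun S => S `<=` E)) => [//|A B AE BE|j /andP[_ bj] w Fw].
  by rewrite subUset.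
exact: bE Fw bj.
Qed.

(** The atoms inside [E] and those inside its complement give lower bounds for the two
    probabilities. The bounds add up to 1, so both are equalities. *)
Lemma discrete_law_event (E : set T) (b : nat -> bool) : measurable E ->
  (forall w j, X w = j%:R -> b j <-> E w) ->
  P E = (\sum_(k <= j < n.+1) p j * (b j)%:R)%:E.
Proof.
move=> mE bE.
have h1 := law_ge mE (fun w j Xw => (bE w j Xw).1).
have h2 : ((\sum_(k <= j < n.+1) p j * (~~ b j)%:R)%:E <= P (~` E))%E.
  apply: law_ge => [|w j Xw /negP nb Ew]; first exact: measurableC.
  by apply: nb; apply/(bE w j Xw).
move: h1 h2; rewrite probability_setC//.
have : P E \is a fin_num by exact: fin_num_measure.
case: (P E) => // q _; rewrite -EFinB !lee_fin => h1 h2.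
congr EFin; apply/eqP; rewrite eq_le h1 andbT.
move: h2; rewrite lerBrDr -lerBrDl => /le_trans; apply.
rewrite -{1}sum_p -sumrB; apply: ler_sum => j _.
by case: (b j); rewrite ?mulr1 ?mulr0 ?subr0 ?subrr.
Qed.

End discrete_law.

(** * Logarithmic normalization and the limit of the r-Lah distribution function *)

Section rlah_normalization.
Context {R : realType} (k : nat) (r : R).
Hypotheses (r0 : 0 <= r) (kr0 : 0 < k%:R + r).
Let mean n : R := (k%:R + r) * ln n%:R.
Let sd n : R := Num.sqrt (mean n).

Let mean_cvgy : mean n @[n --> \oo] --> +oo.
Proof.
apply/cvgryPge => A; near=> n; rewrite /mean -ler_pdivrMl//.
by near: n; move/cvgryPge: (@cvg_ln_nat R); apply.
Unshelve. all: by end_near. Qed.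

Lemma rlah_sd_gt0 : \forall n \near \oo, 0 < sd n.
Proof.
near=> n; rewrite sqrtr_gt0.
by near: n; move/cvgryPgt: mean_cvgy; apply.
Unshelve. all: by end_near. Qed.

Lemma rlah_sd_cvg : (sd n)^-1 @[n --> \oo] --> (0 : R).
Proof.
apply/(gtr0_cvgV0 rlah_sd_gt0); apply/cvgryPge => A; near=> n.
apply: (@le_trans _ _ `|A|); first exact: ler_norm.
(* The absolute value of [A] is the square root of [A ^+ 2], so it suffices that the mean exceeds
   [A ^+ 2]. *)
rewrite -sqrtr_sqr ler_sqrt//.
  by near: n; move/cvgryPge: mean_cvgy; apply.
by near: n; move/cvgryPge: mean_cvgy; apply.
Unshelve. all: by end_near. Qed.

Let bounded_over_cvg0 (u v : nat -> R) (K : R) :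
  (forall n, (0 < n)%N -> `|u n| <= K) -> v n @[n --> \oo] --> (0 : R) ->
  u n * v n @[n --> \oo] --> (0 : R).
Proof.
move=> uK v0; apply/norm_cvg0P.
apply: (@squeeze_cvgr _ _ _ _ (fun=> 0) (fun n => K * `|v n|)).
- near=> n; rewrite normr_ge0/= normrM ler_wpM2r// uK//.
  by near: n; exact: nbhs_infty_gt.
- exact: cvg_cst.
- rewrite -[X in _ --> X](mulr0 K) -(@normr0 _ R).
  by apply: cvgM; [exact: cvg_cst|exact: cvg_norm].
Unshelve. all: by end_near. Qed.

Lemma rlah_mean_cvg :
  (bern_mean (rlah_ps k r n) - mean n) / sd n @[n --> \oo] --> (0 : R).
Proof.
have [K hK] := rlah_ps_mean r0 kr0.
exact: bounded_over_cvg0 hK rlah_sd_cvg.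
Qed.

Lemma rlah_var_cvg :
  bern_var (rlah_ps k r n) / sd n ^+ 2 @[n --> \oo] --> (1 : R).
Proof.
have [K hK] := rlah_ps_var r0 kr0.
have h : (bern_var (rlah_ps k r n) - mean n) * (sd n)^-1 ^+ 2
    @[n --> \oo] --> (0 : R).
  apply: (bounded_over_cvg0 hK).
  rewrite -[X in _ --> X](mulr0 (0 : R)); under eq_fun do rewrite expr2.
  by apply: cvgM; exact: rlah_sd_cvg.
(* Once [sd n] is positive, the quotient is 1 plus the bounded difference of variance and mean over
   [sd n ^+ 2]. *)
rewrite -[X in _ --> X]add0r.
have h1 : (bern_var (rlah_ps k r n) - mean n) * (sd n)^-1 ^+ 2 + 1
    @[n --> \oo] --> (0 + 1 : R) by apply: cvgD => //; exact: cvg_cst.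
apply: cvg_trans h1.
apply: near_eq_cvg; near=> n.
have sd0 : 0 < sd n by near: n; exact: rlah_sd_gt0.
have <- : sd n ^+ 2 = mean n by rewrite sqr_sqrtr// ltW// -sqrtr_gt0.
by rewrite /=; field; rewrite gt_eqF.
Unshelve. all: by end_near. Qed.

Lemma rlah_bern_std_cvg (h : R -> R) (K : R) : lipschitz_by K h ->
  (forall x, 0 <= h x <= 1) ->
  bern_std (rlah_ps k r) mean sd h n @[n --> \oo] --> normal_exp h.
Proof.
move=> hK h01; apply: bern_std_cvg hK h01.
- exact: rlah_ps_prob.
- exact: rlah_sd_gt0.
- exact: rlah_sd_cvg.
- exact: rlah_var_cvg.
- exact: rlah_mean_cvg.
Qed.

(** The indicator of the half-line lies between the ramps starting at [x - dl] and at [x]. Passing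
    from the r-Lah law to the Bernoulli sum, from there to the normal law, and from the ramps back
    to [Phi x] costs at most [e / 4] each. *)
Lemma rlah_cdf_cvg (x : R) :
  {for x, continuous (fun y : R => normal_prob (0 : R) 1 `]-oo, y]%classic)} ->
  \sum_(k <= j < n.+1) lah_pmf n k r j * (stdz (mean n) (sd n) j <= x)%R%:R
    @[n --> \oo] --> normal_exp (\1_(`]-oo, x]) : R -> R).
Proof.
pose Phi (y : R) : R := normal_exp (\1_(`]-oo, y]) : R -> R).
have PhiE (y : R) : normal_prob (0 : R) 1 `]-oo, y]%classic = (Phi y)%:E.
  exact: normal_prob_indic.
move=> cx; have cPhi : Phi y @[y --> x] --> Phi x.
  have -> : Phi = fine \o (fun y : R => normal_prob (0 : R) 1 `]-oo, y]%classic).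
    by apply/funext => y /=; rewrite PhiE.
  by apply: fine_cvg; rewrite /= PhiE -PhiE; exact: cx.
apply/cvgrPdist_le => /= e e0.
have e4 : 0 < e / 4 by rewrite divr_gt0.
have [dl dl0 Phi_dl] : exists2 dl, 0 < dl &
    forall y, `|x - y| <= dl -> `|Phi x - Phi y| <= e / 4.
  move/cvgrPdist_le: cPhi => /(_ _ e4)/nbhs_ballP[dl /= dl0 Phi_dl].
  (* Halving the radius turns the open ball into a closed condition. *)
  exists (dl / 2); first by rewrite divr_gt0.
  move=> y xy; apply: Phi_dl; rewrite /ball /= (le_lt_trans xy)//.
  by rewrite ltr_pdivrMr// ltr_pMr// ltr1n.
have ind_itv (a y : R) : \1_(`]-oo, a]) y = (y <= a)%R%:R :> R.
  by rewrite indicE; congr (nat_of_bool _)%:R; apply/idP/idP; rewrite inE /= in_itv.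
have ramp_exp (a : R) : Phi a <= normal_exp (ramp a dl) <= Phi (a + dl).
  have mi (b : R) : measurable_fun setT (\1_(`]-oo, b]) : R -> R).
    exact: measurable_indic.
  have mr := continuous_measurable_fun
    (lipschitz_by_continuous (ramp_lipschitz a dl0)).
  have i1 (b y : R) : `|\1_(`]-oo, b]) y : R| <= 1.
    by rewrite ind_itv; case: (y <= b)%R; rewrite ?normr1 ?normr0.
  have r1 y : `|ramp a dl y| <= 1.
    by have /andP[? ?] := clamp_itv ((a + dl - y) / dl); rewrite ger0_norm.
  by apply/andP; split; apply: (@le_normal_exp _ _ _ 1) => // y;
    rewrite ind_itv ?le_ramp ?ramp_le.
have ramp01 a y : 0 <= ramp a dl y <= 1 by exact: clamp_itv.
have std_near (a : R) : \forall n \near \oo, `|normal_exp (ramp a dl) -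
    bern_std (rlah_ps k r) mean sd (ramp a dl) n| <= e / 4.
  have := rlah_bern_std_cvg (ramp_lipschitz a dl0) (ramp01 a).
  by move/cvgrPdist_le; apply.
near=> n.
have kn : (k <= n)%N by near: n; exact: nbhs_infty_ge.
have gap_e : lah_gap k r n <= e / 4.
  by near: n; apply: (cvgr_le _ (lah_gap_cvg0 r0 kr0)).
have gap_1 : lah_gap k r n < 1.
  by near: n; apply: (cvgr_lt _ (lah_gap_cvg0 r0 kr0)).
pose w := stdz (mean n) (sd n).
have std_e (a : R) : a = x \/ a = x - dl ->
    `|normal_exp (ramp a dl) -
      bern_std (rlah_ps k r) mean sd (ramp a dl) n| <= e / 4.
  by case=> ->; near: n; exact: std_near.
have pmf_e (a : R) := lah_pmf_bernE r0 kr0 kn gap_1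
  (fun j => ramp01 a (w j)).
have up : \sum_(k <= j < n.+1) lah_pmf n k r j * (w j <= x)%R%:R
  <= \sum_(k <= j < n.+1) lah_pmf n k r j * ramp x dl (w j).
  by apply: ler_sum => j _; rewrite ler_wpM2l ?lah_pmf_ge0// le_ramp.
have down : \sum_(k <= j < n.+1) lah_pmf n k r j * ramp (x - dl) dl (w j)
  <= \sum_(k <= j < n.+1) lah_pmf n k r j * (w j <= x)%R%:R.
  apply: ler_sum => j _; rewrite ler_wpM2l ?lah_pmf_ge0//.
  by rewrite -[in leRHS](subrK dl x) ramp_le.
have P1 : `|Phi x - Phi (x + dl)| <= e / 4.
  by apply: Phi_dl; rewrite opprD addrA subrr add0r normrN gtr0_norm.
have P2 : `|Phi x - Phi (x - dl)| <= e / 4.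
  by apply: Phi_dl; rewrite opprB addrC subrK gtr0_norm.
have := std_e x (or_introl erefl); have := std_e (x - dl) (or_intror erefl).
have := pmf_e x; have := pmf_e (x - dl).
have := ramp_exp x; have := ramp_exp (x - dl); rewrite subrK.
rewrite -/(Phi x) /bern_std -/w.
move: P1 P2; rewrite !ler_norml.
do 8! move=> /andP[? ?].
by apply/andP; split; lra.
Unshelve. all: by end_near. Qed.

End rlah_normalization.

Theorem theorem3p13 (R : realType) (k : nat) (r : R)
    (d : nat -> measure_display)
    (T : forall n : nat, measurableType (d n))
    (P : forall n : nat, probability (T n) R)
    (Lah : forall n : nat, {RV (P n) >-> R}) :
  0 <= r -> 0 < Num.max k%:R r ->
  (forall n : nat, (0 < n)%N -> (k <= n)%N -> lah_distributed n k r (Lah n)) ->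
  cvg_in_distribution
    (fun n : nat => standardize (Lah n) ((k%:R + r) * ln n%:R)
                      (Num.sqrt ((k%:R + r) * ln n%:R)))
    (normal_prob (0 : R) 1).
Proof.
move=> r0 kr law x cx.
have kr0 : 0 < k%:R + r.
  move: kr; rewrite lt_max => /orP[k0|r_gt0]; first by rewrite ltr_wpDr.
  by rewrite ltr_wpDl.
rewrite /= normal_prob_indic//.
pose mean n : R := (k%:R + r) * ln n%:R; pose sd n : R := Num.sqrt (mean n).
(* The law is prescribed only for positive [n >= k], and the masses are known to sum to 1 once
   [lah_gap] is below 1; both hold eventually. *)
have cdfE : \forall n \near \oo, cdf (standardize (Lah n) (mean n) (sd n)) x =
    (\sum_(k <= j < n.+1) lah_pmf n k r j *
      (stdz (mean n) (sd n) j <= x)%R%:R)%:E.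
  near=> n.
  have kn : (k <= n)%N by near: n; exact: nbhs_infty_ge.
  have n0 : (0 < n)%N by near: n; exact: nbhs_infty_gt.
  have gap_1 : lah_gap k r n < 1.
    by near: n; apply: (cvgr_lt _ (lah_gap_cvg0 r0 kr0)).
  rewrite /cdf /distribution /pushforward.
  apply: (discrete_law_event (law n n0 kn)).
  - exact: sum_lah_pmf.
  - by rewrite -[X in measurable X]setTI; exact: measurable_funP.
  - by move=> w j Xw; rewrite /= in_itv /= Xw.
apply: cvg_EFin; first by apply: filterS cdfE => n ->.
apply: cvg_trans (rlah_cdf_cvg r0 kr0 cx); apply: near_eq_cvg.
by apply: filterS cdfE => n /= ->.
Unshelve. all: by end_near. Qed.
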